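(* Let $r,d\ge 0$ be integers and let $\Delta\subset\mathbb{R}^3$ be a closed tetrahedral vertex star with interior vertex $\gamma$ and $f_1^\circ$ interior edges, which is generic with respect to $r$ and $d$. Put \[ D_\gamma:=\begin{cases} 2r & f_1^\circ=4,\\ \lfloor (5r+2)/3\rfloor & f_1^\circ=5,\\ \lfloor (3r+1)/2\rfloor & f_1^\circ\ge 6.\end{cases} \] If $d\le D_\gamma$, then $\dim \mathcal{H}^r_d(\Delta)=\binom{d+2}{2}$.
   Context: A tetrahedral vertex star is a pure $3$-dimensional simplicial complex $\Delta$ embedded in $\mathbb{R}^3$ all of whose tetrahedra share a common vertex $\gamma$ (placed at the origin), which is hereditary (whenever two tetrahedra meet in a vertex $v$, they are joined by a sequence of tetrahedra all containing $v$, consecutive ones sharing a triangle) and whose link (the simplices not containing $\gamma$) is simply connected. It is closed if $\gamma$ is an interior point of $\Delta$. $f_1^\circ$ is the number of interior edges. $\mathcal{H}^r_d(\Delta)$ is the real vector space of $C^r$ functions on $\Delta$ whose restriction to each tetrahedron is a homogeneous polynomial of degree $d$ in $x,y,z$ (or zero). $\Delta$ is generic with respect to $r,d$ if for all sufficiently small perturbations of the vertices other than $\gamma$, the resulting vertex star $\Delta'$ satisfies $\dim\mathcal{H}^r_d(\Delta')=\dim\mathcal{H}^r_d(\Delta)$. *)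

(* Defs.v *)
From mathcomp Require Import all_boot all_order all_algebra.
From mathcomp Require Import all_classical all_reals all_analysis.
(* The notations of mpoly clash with those of analysis. *)
From mathcomp Require Import -(notations) mpoly.

Set Implicit Arguments.
Unset Strict Implicit.
Unset Printing Implicit Defensive.

Import Order.TTheory GRing.Theory Num.Theory.
Import numFieldNormedType.Exports.

Local Open Scope classical_set_scope.
Local Open Scope ring_scope.

Section Complexes.
Variables (R : realType) (V : finType).
Local Notation E := 'rV[R]_3.
Implicit Types (Delta : {set {set V}}) (p : V -> E) (s t : {set V}).

(* The empty simplex is included, as is usual for abstract complexes; its hull
   below is empty. *)
Definition is_complex Delta :=
  [/\ finset.set0 \in Delta,
      forall v, [set v]%SET \in Delta &
      forall s t, s \in Delta -> t \subset s -> t \in Delta].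

(* A k-simplex has k + 1 vertices. *)
Definition tetrahedra Delta : {set {set V}} :=
  [set s in Delta | #|s| == 4%N]%SET.

Definition pure3 Delta :=
  forall s, s \in Delta -> exists2 T, T \in tetrahedra Delta & s \subset T.

Definition hull p s : set E :=
  [set x | exists w : V -> R,
     [/\ forall v, 0 <= w v, forall v, v \notin s -> w v = 0,
         \sum_v w v = 1 & x = \sum_v w v *: p v]].

Definition affinely_independent p s :=
  forall w : V -> R, \sum_(v in s) w v = 0 -> \sum_(v in s) w v *: p v = 0 ->
  forall v, v \in s -> w v = 0.

Definition embedded Delta p :=
  (forall s, s \in Delta -> affinely_independent p s) /\
  (forall s t, s \in Delta -> t \in Delta ->
     hull p s `&` hull p t = hull p (s :&: t)%SET).

Definition realization Delta p : set E := \bigcup_(s in [set` Delta]) hull p s.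

Definition hereditary Delta :=
  forall v S T, S \in tetrahedra Delta -> T \in tetrahedra Delta ->
    v \in S -> v \in T ->
  connect [rel A B | [&& A \in tetrahedra Delta, B \in tetrahedra Delta,
                         v \in A, v \in B & #|A :&: B|%SET == 3%N]] S T.

Definition link Delta (gamma : V) : {set {set V}} :=
  [set s in Delta | gamma \notin s]%SET.

Definition path_in (A : set E) (f : R -> E) :=
  {within `[0, 1], continuous f} /\ (forall u : R, u \in `[0, 1] -> A (f u)).

Definition path_connected (A : set E) :=
  A !=set0 /\
  forall x y, A x -> A y -> exists f, [/\ path_in A f, f 0 = x & f 1 = y].

(* Every loop is null-homotopic relative to its base point. *)
Definition simply_connected (A : set E) :=
  path_connected A /\
  forall f, path_in A f -> f 0 = f 1 ->
  exists H : R * R -> E,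
    [/\ {within `[0, 1]%classic `*` `[0, 1]%classic, continuous H},
        forall u v : R, u \in `[0, 1] -> v \in `[0, 1] -> A (H (u, v)),
        forall u : R, u \in `[0, 1] -> H (u, 0) = f u,
        forall u : R, u \in `[0, 1] -> H (u, 1) = f 0 &
        forall v : R, v \in `[0, 1] -> H (0, v) = f 0 /\ H (1, v) = f 0].

Record vertex_star Delta p (gamma : V) : Prop := VertexStar {
  star_complex : is_complex Delta;
  star_pure : pure3 Delta;
  star_embedded : embedded Delta p;
  star_center : forall T, T \in tetrahedra Delta -> gamma \in T;
  star_origin : p gamma = 0;
  star_hereditary : hereditary Delta;
  star_link : simply_connected (realization (link Delta gamma) p)
}.

Definition closed_star Delta p (gamma : V) :=
  (realization Delta p)° (p gamma).

(* An edge is interior when it is not contained in the boundary of |Delta|; as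
   |Delta| is closed, its boundary is |Delta| minus its interior. *)
Definition interior_edges Delta p : {set {set V}} :=
  [set e in Delta | (#|e| == 2%N) &&
     ~~ `[< hull p e `<=` realization Delta p `\` (realization Delta p)° >] ]%SET.

Definition num_interior_edges Delta p : nat := #|interior_edges Delta p|.

End Complexes.

Section Splines.
Variable R : realType.
Local Notation E := 'rV[R]_3.

Fixpoint Cr_open (r : nat) (U : set E) (g : E -> R) : Prop :=
  (forall x, U x -> {for x, continuous g}) /\
  if r is r'.+1 then
    forall i : 'I_3,
      (forall x, U x -> derivable g x (delta_mx 0 i)) /\
      Cr_open r' U (fun x => 'D_(delta_mx 0 i) g x)
  else True.

(* On a set which need not be open, C^r means having a C^r extension to an open
   neighbourhood. *)
Definition Cr_on (r : nat) (X : set E) (f : X -> R) : Prop :=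
  exists U (g : E -> R),
    [/\ open U, X `<=` U, Cr_open r U g & forall x : X, f x = g (val x)].

Definition homogeneous (d : nat) (q : mpoly 3 R) : bool :=
  q \is ishomog1 d mdeg.

Definition spline_space (V : finType) (Delta : {set {set V}}) (p : V -> E)
    (r d : nat) : set (realization Delta p -> R^o) :=
  [set f | Cr_on r f /\
     forall T, T \in tetrahedra Delta ->
     exists2 q, homogeneous d q &
       forall x : realization Delta p, hull p T (val x) ->
         f x = meval (val x ord0) q].

End Splines.

Arguments spline_space {R V} Delta p r d.

(* The equation for W also says that W is a linear subspace. *)
Definition has_dim (R : realType) (M : lmodType R) (W : set M) (n : nat) :=
  exists b : 'I_n -> M,
    (forall c : 'I_n -> R, \sum_i c i *: b i = 0 -> forall i, c i = 0) /\
    W = range (fun c : 'I_n -> R => \sum_i c i *: b i).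

(* For eps small enough, the moved vertices again span a closed vertex star. *)
Definition generic (R : realType) (V : finType) (Delta : {set {set V}})
    (p : V -> 'rV[R]_3) (gamma : V) (r d : nat) :=
  exists2 eps : R, 0 < eps &
  forall p' : V -> 'rV[R]_3, p' gamma = p gamma ->
    (forall v, `|p' v - p v| < eps) ->
  forall n, has_dim (spline_space Delta p' r d) n <->
            has_dim (spline_space Delta p r d) n.

(* A closed vertex star always has at least four interior edges, so the default
   case is f1 >= 6. *)
Definition D_gamma (f1 r : nat) : nat :=
  (if f1 == 4 then 2 * r
   else if f1 == 5 then (5 * r + 2) %/ 3
   else (3 * r + 1) %/ 2)%N.

(* Main.v *)
(* Cofactors: two polynomials on adjacent tetrahedra agree to order n = r + 1 along
   the plane of the common triangle, and "no nontrivial spline" is an algebraic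
   condition on the polynomials, an injectivity statement for a matrix whose entries
   are polynomial in the vertices. If it holds for one position of the vertices, it
   holds on a dense set of positions, in particular arbitrarily close to the given
   one, and genericity transports the dimension back. No embedding is needed at the
   special position; only the combinatorics of the link matters: it is a connected
   closed surface, because the cones over the tetrahedra cover space.

   Local input: around a ray, powers of distinct linear forms in two variables are
   independent in degree m as long as the dimensions m + 1 - n_i add up to at most
   m + 1.

   Four vertices: the three planes at a ray force vanishing to order 3n/2 there, and
   the orders at two rays add up to more than d + n, so the order across the plane of
   the two rays increases, and one iterates. Five vertices: the link is a
   bipyramid, and the same argument works with orders 3n/2 at the apexes and 4n/3 on the
   equator.

   In general, order the vertices so that each is joined to two earlier ones and let
   them converge to a single ray at rapidly increasing speeds. In the limit all planes
   contain this ray, and the plane of an edge depends only on its earlier vertex.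
   For a tetrahedron a < k < c, the polynomial agrees with the common value of the
   earlier ones modulo the n-th power of the form of a (walk around a); walking around k
   from c, away from a, one meets another earlier neighbour a' of k, and the two
   polynomials agree modulo the form of k. Three distinct forms give a trivial
   difference when 2d + 2 <= 3n. *)
Require Import Defs.
From mathcomp Require Import all_boot all_order all_algebra.
From mathcomp Require Import all_classical all_reals all_analysis.
From mathcomp Require Import -(notations) mpoly.
From mathcomp Require Import ring lra zify.

Set Implicit Arguments.
Unset Strict Implicit.
Unset Printing Implicit Defensive.

Import Order.TTheory GRing.Theory Num.Theory.
Import numFieldNormedType.Exports.

Local Open Scope ring_scope.

(** * Powers of linear forms in two variables *)

Lemma poly_fun_eq (R : numDomainType) (p q : {poly R}) :
  (forall x, p.[x] = q.[x]) -> p = q.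
Proof.
move=> pq; apply/eqP; rewrite -subr_eq0; apply/negPn/negP => nz.
pose s : seq R := [seq i%:R | i <- iota 0 (size (p - q))].
have rs : all (root (p - q)) s.
  by apply/allP => x _; rewrite rootE !hornerE pq subrr.
have us : uniq s by rewrite map_inj_uniq ?iota_uniq // => i j /eqP; rewrite eqr_nat => /eqP.
by have := max_poly_roots nz rs us; rewrite size_map size_iota ltnn.
Qed.

Lemma dvdp_XnP (R : fieldType) (k : nat) (p : {poly R}) :
  reflect (forall i, (i < k)%N -> p`_i = 0) ('X^k %| p).
Proof.
apply: (iffP idP) => [/dvdpP [q ->] i ik|z]; first by rewrite coefMXn ik.
have -> : p = drop_poly k p * 'X^k.
  rewrite -{1}(poly_take_drop k p) [take_poly k p](_ : _ = 0) ?add0r //.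
  by apply/polyP => i; rewrite coef_take_poly coef0; case: ifP => // /z.
exact: dvdp_mull.
Qed.

Lemma dvdp_size0 (R : fieldType) (p q : {poly R}) :
  p %| q -> (size q < size p)%N -> q = 0.
Proof.
move=> pq lt; apply/eqP/negPn/negP => nz.
by have := dvdp_leq nz pq; rewrite leqNgt lt.
Qed.

Section Powers.
Variable R : numFieldType.
Implicit Types (c : R) (h : {poly R}).

(* The derivative in direction (1, c) of the binary form of degree m whose
   dehomogenization is h. *)
Definition polar (m : nat) c h := m%:R *: h + (c%:P - 'X) * h^`().

(** Euler's identity: the coefficients of degree m of the two summands cancel. *)
Lemma size_polar m c h :
  (size h <= m.+1)%N -> (size (polar m c h) <= m)%N.
Proof.
move=> sz; apply/leq_sizeP => j mj.
rewrite /polar coefD coefZ mulrBl coefB coefCM coefXM !coef_deriv.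
case: j mj => [|j] mj.
  have m0 : m = 0%N by lia.
  rewrite m0 in sz mj *.
  have -> : h`_1 = 0 by apply: (leq_sizeP _ _ sz); lia.
  by rewrite mul0r mul0rn mulr0 subr0 addr0.
have -> : h`_j.+2 = 0 by apply: (leq_sizeP _ _ sz); lia.
rewrite mul0rn mulr0 sub0r /=.
have [->|ne] := eqVneq j.+1 m; first by rewrite mulr_natl subrr.
have -> : h`_j.+1 = 0 by apply: (leq_sizeP _ _ sz); lia.
by rewrite mulr0 mul0rn subrr.
Qed.

Lemma polar_mul_exp m c c' k h :
  polar m c (h * ('X - c'%:P) ^+ k.+1) =
  (('X - c'%:P) * (m%:R *: h + (c%:P - 'X) * h^`()) + k.+1%:R *: (c%:P - 'X) * h)
  * ('X - c'%:P) ^+ k.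
Proof.
rewrite /polar derivM deriv_exp derivXsubC mul1r /= exprS -!mul_polyC.
by rewrite -[_ *+ k.+1]mulr_natl -[in LHS]polyC_natr; ring.
Qed.

Lemma dvdp_polar m c c' k h :
  ('X - c'%:P) ^+ k %| h -> ('X - c'%:P) ^+ k.-1 %| polar m c h.
Proof.
move=> /dvdpP [q ->]; case: k => [|k]; first exact: dvd1p.
by rewrite polar_mul_exp dvdp_mull.
Qed.

(** The linear form with root c is constant in the direction (1, c), so differentiating in this
    direction costs no multiplicity at c; at other roots it costs at most one. *)
Lemma dvdp_polar_center m c k h :
  ('X - c%:P) ^+ k %| h -> ('X - c%:P) ^+ k %| polar m c h.
Proof.
move=> /dvdpP [q ->]; case: k => [|k]; first exact: dvd1p.
rewrite polar_mul_exp exprS dvdp_mul //.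
rewrite dvdp_add ?dvdp_mulIl // dvdp_mulr // -mul_polyC dvdp_mull //.
by rewrite -[c%:P - 'X]opprB dvdpNr.
Qed.

(** A form killed by the derivative in the direction (1, c) is a multiple of a power of the linear
    form with root c. Concretely, a root at [c'] would have every multiplicity. *)
Lemma polar_eq0 m c c' h :
  c' != c -> ('X - c'%:P) %| h -> polar m c h = 0 -> h = 0.
Proof.
move=> cc d1 eq0.
have dv k : ('X - c'%:P) ^+ k.+1 %| h.
  elim: k => [|k /dvdpP [q qE]]; first by rewrite expr1.
  move: eq0; rewrite qE polar_mul_exp => /eqP; rewrite mulf_eq0.
  rewrite (negbTE (expf_neq0 _ _)) ?polyXsubC_eq0 // orbF => /eqP eq0.
  have : root (('X - c'%:P) * (m%:R *: q + (c%:P - 'X) * q^`()) +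
               k.+1%:R *: (c%:P - 'X) * q) c' by rewrite eq0 root0.
  rewrite rootE !hornerE subrr mul0r add0r !mulf_eq0 pnatr_eq0 /=.
  rewrite subr_eq0 eq_sym (negbTE cc) /= => q0.
  by rewrite exprS dvdp_mul // dvdp_XsubCl rootE.
by apply: (dvdp_size0 (dv (size h))); rewrite size_exp_XsubC.
Qed.

(** Induction on the degree, differentiating in the direction of one form [t]. The order at [c t] is
    kept and the other orders drop by one, so only the summand of [t] shrinks, by one, as does the
    bound. Once all derivatives vanish, [polar_eq0] kills every [h j] with j different from t, and
    the relation kills [h t]. *)
Lemma powers_independent (I : finType) (m : nat) (c : I -> R) (n : I -> nat)
    (h : I -> {poly R}) :
  injective c ->
  (forall i, size (h i) <= m.+1)%N ->
  (forall i, ('X - (c i)%:P) ^+ n i %| h i) ->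
  \sum_i h i = 0 ->
  (\sum_i (m.+1 - n i) <= m.+1)%N ->
  forall i, h i = 0.
Proof.
move=> c_inj; elim: m n h => [|m IH] n h sz dv s0 le.
all: have big i : (forall j, j = i -> (size (h j) <= n j)%N) -> h i = 0
  by move=> /(_ i erefl) hi; apply: (dvdp_size0 (dv i)); rewrite size_exp_XsubC.
all: have other t (i : I) : (forall j, j != t -> h j = 0) -> h i = 0
  by move=> z; have [->|/z //] := eqVneq i t; move: s0; rewrite (bigD1 t) //= big1 ?addr0.
- case: (pickP (fun t => n t <= 0)%N) => [t nt|none] i; last first.
    by apply: big => j ->; apply: leq_trans (sz i) _; rewrite ltnNge none.
  apply: (other t) => j jt; apply: big => k ->.
  apply: leq_trans (sz j) _; move: le.
  rewrite (bigD1 t) //= (bigD1 j) //=; move: (n t) nt (n j) => a b e; lia.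
(* The summand of [t] must be positive for the sum to drop; if no such [t] exists, all orders exceed
   the degree. *)
- case: (pickP (fun t => n t <= m.+1)%N) => [t nt|none] i; last first.
    by apply: big => j ->; apply: leq_trans (sz i) _; rewrite ltnNge none.
  (* Order zero would contribute m + 2 by itself, leaving no room for the positive summand of
     [t]. *)
  have n_gt0 j : j != t -> (0 < n j)%N.
    move=> jt; move: le; rewrite (bigD1 t) //= (bigD1 j) //=; lia.
  pose n' j := if j == t then n t else (n j).-1.
  have D0 : forall j, polar m.+1 (c t) (h j) = 0.
    apply: (IH n') => [j|j||].
    + exact: size_polar.
    + rewrite /n'; case: eqP => [->|_]; first exact: dvdp_polar_center.
      exact: dvdp_polar.
    + rewrite /polar big_split /= -scaler_sumr s0 scaler0 add0r -mulr_sumr.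
      by rewrite -raddf_sum s0 raddf0 mulr0.
    + rewrite (bigD1 t) //= /n' eqxx.
      rewrite (eq_bigr (fun j => m.+2 - n j)%N); last first.
        by move=> j jt; rewrite (negbTE jt); have := n_gt0 _ jt; lia.
      by move: le; rewrite (bigD1 t) //=; lia.
  apply: (other t) => j jt.
  apply: (@polar_eq0 m.+1 (c t) (c j) (h j)) (D0 j); first by rewrite (inj_eq c_inj).
  by apply: dvdp_trans (dv j); rewrite -(prednK (n_gt0 _ jt)) exprS dvdp_mulIl.
Qed.
End Powers.

(** * Vanishing orders of ternary forms *)

Section Homogeneous.
Variable R : realType.
Local Notation E := 'rV[R]_3.
Implicit Types (q : mpoly 3 R) (x u v w : E) (h : {poly R}) (d : nat).

Lemma homogeneous_ind (P : nat -> mpoly 3 R -> Prop) :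
  P 0%N 1 ->
  (forall d i q, P d q -> P d.+1 (mpolyX R (mnm1 i) * q)) ->
  (forall d, P d 0) ->
  (forall d c p q, P d p -> P d q -> P d (c *: p + q)) ->
  forall d q, homogeneous d q -> P d q.
Proof.
move=> P1 PX P0 PD d q hq.
have PM m : P (mdeg m) (mpolyX R m).
  move: {1}(mdeg m) (erefl (mdeg m)) => e.
  elim: e m => [|e IH] m em.
    by rewrite -em; move/esym/eqP: em; rewrite mdeg_eq0 => /eqP ->; rewrite mpolyX0.
  have [i mi] : exists i, (0 < m i)%N.
    case: (pickP (fun i => 0 < m i)%N) => [i|none]; first by exists i.
    move: em; rewrite mdegE big1 // => i _.
    by have := none i; case: (m i).
  have mE : m = mnm_add (mnm1 i) (mnm_sub m (mnm1 i)).
    by apply/mnmP => j; rewrite mnmDE mnmBE mnm1E; case: eqP => [<-|_]; lia.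
  rewrite -em mE mpolyXD; apply: PX.
  have de : e = mdeg (mnm_sub m (mnm1 i)).
    by apply: succn_inj; rewrite em {1}mE mdegD mdeg1.
  by rewrite de; apply: IH.
rewrite (mpolyE q); move/dhomogP: hq => /= hq.
elim: (msupp q) hq => [|m s IH] hq; first by rewrite big_nil.
rewrite big_cons; apply: PD; last by apply: IH => k ks; apply: hq; rewrite inE ks orbT.
by rewrite -(hq m (mem_head _ _)).
Qed.

(** The homogenization of [h] to degree m; Y = 1 gives back [h] when its degree is at most m. *)
Definition binary (m : nat) (h : {poly R}) (Y Z : R) :=
  \sum_(j < m.+1) h`_j * Y ^+ (m - j) * Z ^+ j.

Lemma binaryD (m : nat) h k Y Z : binary m (h + k) Y Z = binary m h Y Z + binary m k Y Z.
Proof. by rewrite -big_split; apply: eq_bigr => j _; rewrite coefD !mulrDl. Qed.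

Lemma binaryZ (m : nat) a h Y Z : binary m (a *: h) Y Z = a * binary m h Y Z.
Proof. by rewrite mulr_sumr; apply: eq_bigr => j _; rewrite coefZ !mulrA. Qed.

Lemma binary0 (m : nat) Y Z : binary m 0 Y Z = 0.
Proof. by rewrite /binary big1 // => j _; rewrite coef0 !mul0r. Qed.

Lemma binary_mulY (m : nat) h Y Z :
  (size h <= m.+1)%N -> binary m.+1 h Y Z = Y * binary m h Y Z.
Proof.
move=> sz; rewrite /binary big_ord_recr /= nth_default // !mul0r addr0 mulr_sumr.
apply: eq_bigr => j _; rewrite subSn -1?ltnS // exprS; ring.
Qed.

Lemma binary_mulZ (m : nat) h Y Z : binary m.+1 ('X * h) Y Z = Z * binary m h Y Z.
Proof.
rewrite /binary big_ord_recl /= coefXM !mul0r add0r mulr_sumr.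
apply: eq_bigr => j _; rewrite coefXM /= /bump /= add1n /= subSS exprS; ring.
Qed.

Lemma binary_scale (m : nat) h t Y Z :
  binary m h (t * Y) (t * Z) = t ^+ m * binary m h Y Z.
Proof.
rewrite /binary mulr_sumr; apply: eq_bigr => j _.
have -> : t ^+ m = t ^+ (m - j) * t ^+ j by rewrite -exprD subnK // -ltnS.
rewrite !exprMn; ring.
Qed.

Lemma binary1 (m : nat) h t : (size h <= m.+1)%N -> binary m h 1 t = h.[t].
Proof.
move=> sz; rewrite (horner_coef_wide _ sz); apply: eq_bigr => j _.
by rewrite expr1n mulr1.
Qed.

(** Sorting by powers of X leaves a binary form [h m] of degree m in Y and Z. When u, v, w form a
    basis, the order at [u] is the first m with [h m] nonzero. *)
Lemma homogeneous_expansion d q u v w : homogeneous d q ->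
  exists h : nat -> {poly R},
    [/\ forall m, (size (h m) <= m.+1)%N, forall m, (d < m)%N -> h m = 0 &
      forall X Y Z, meval ((X *: u + Y *: v + Z *: w) ord0) q =
        \sum_(m < d.+1) X ^+ (d - m) * binary m (h m) Y Z].
Proof.
move: d q; apply: homogeneous_ind.
- exists (fun m => if m == 0%N then 1 else 0); split=> [m|m|X Y Z].
  + by case: eqP => [->|]; rewrite ?size_poly1 ?size_poly0.
  + by case: m.
  + by rewrite meval1 big_ord1 /binary big_ord1 /= coef1 !expr0 !mulr1.
- move=> d i q [h [sz z E]].
  exists (fun m => (u ord0 i) *: h m +
    if m is m'.+1 then (v ord0 i) *: h m' + (w ord0 i) *: ('X * h m') else 0); split.
  + case=> [|m]; rewrite (leq_trans (size_polyD _ _)) // geq_max.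
      by rewrite size_poly0 andbT (leq_trans (size_scale_leq _ _)).
    rewrite (leq_trans (size_scale_leq _ _)) ?(leq_trans (sz _)) //=.
    rewrite (leq_trans (size_polyD _ _)) // geq_max.
    rewrite !(leq_trans (size_scale_leq _ _)) ?(leq_trans (sz _)) //=.
    rewrite (leq_trans (size_polyMleq _ _)) // size_polyX /= ltnS; exact: sz.
  + by case=> // m dm; rewrite !z ?mulr0 ?scaler0 ?addr0 //; lia.
  + move=> X Y Z; rewrite mevalM mevalXU E !mxE.
    under [RHS]eq_bigr => m _ do rewrite binaryD mulrDr.
    rewrite big_split /= [X in _ = X + _]big_ord_recr /= (z d.+1) // scaler0 binary0 mulr0 addr0.
    rewrite [X in _ = _ + X]big_ord_recl /= binary0 mulr0 add0r -big_split /= mulr_sumr.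
    apply: eq_bigr => m _; rewrite binaryD !binaryZ binary_mulZ binary_mulY //.
    rewrite /bump /= add1n subSS subSn -1?ltnS // exprS; ring.
- move=> d; exists (fun=> 0); split=> [m|//|X Y Z]; first by rewrite size_poly0.
  by rewrite meval0 big1 // => m _; rewrite binary0 mulr0.
- move=> d c p q [h [sz z E]] [k [sz' z' E']].
  exists (fun m => c *: h m + k m); split=> [m|m dm|X Y Z].
  + rewrite (leq_trans (size_polyD _ _)) // geq_max sz' andbT.
    by rewrite (leq_trans (size_scale_leq _ _)).
  + by rewrite z // z' // scaler0 addr0.
  + rewrite mevalD mevalZ E E' mulr_sumr -big_split; apply: eq_bigr => m _ /=.
    rewrite binaryD binaryZ; ring.
Qed.

(** The restriction of [q] to the line through [x] with direction [w]; vanishing orders become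
    divisibility by powers of the variable. *)
Definition lin q x w : {poly R} :=
  mmap polyC (fun i => (x ord0 i)%:P + (w ord0 i)%:P * 'X) q.

Lemma horner_lin q x w t : (lin q x w).[t] = meval ((x + t *: w) ord0) q.
Proof.
rewrite /lin /meval /mmap horner_sum; apply: eq_bigr => m _.
rewrite hornerCM /mmap1 horner_prod; congr (_ * _); apply: eq_bigr => i _.
by rewrite horner_exp !hornerE !mxE [t * _]mulrC.
Qed.

Lemma linB p q x w : lin (p - q) x w = lin p x w - lin q x w.
Proof. exact: mmapB. Qed.

Lemma linD (p q : mpoly 3 R) x w : lin (p + q) x w = lin p x w + lin q x w.
Proof. exact: mmapD. Qed.

Lemma linZ c (q : mpoly 3 R) x w : lin (c *: q) x w = c *: lin q x w.
Proof. by rewrite /lin mmapZ mul_polyC. Qed.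

Lemma lin_sum (I : finType) (q : I -> mpoly 3 R) x w :
  lin (\sum_i q i) x w = \sum_i lin (q i) x w.
Proof. exact: raddf_sum. Qed.

Lemma lin0 x w : lin (0 : mpoly 3 R) x w = 0.
Proof. exact: mmap0. Qed.

Lemma linN q x w : lin (- q) x w = - lin q x w.
Proof. exact: mmapN. Qed.

Definition ordat (k : nat) q x := forall w, 'X^k %| lin q x w.

Definition ordplane (k : nat) q u v := forall X Y, ordat k q (X *: u + Y *: v).

Lemma sum_expr_sub_eq0 d (c : nat -> R) :
  (forall X, \sum_(m < d.+1) X ^+ (d - m) * c m = 0) ->
  forall m, (m <= d)%N -> c m = 0.
Proof.
move=> z m md; pose Q := \poly_(k < d.+1) c (d - k)%N.
have Q0 : Q = 0.
  apply: poly_fun_eq => X; rewrite horner0 horner_poly -[RHS](z X).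
  rewrite (reindex_inj rev_ord_inj); apply: eq_bigr => k _ /=.
  by rewrite mulrC subSS subKn // -ltnS.
have : Q`_(d - m) = 0 by rewrite Q0 coef0.
by rewrite coef_poly ltnS leq_subr subKn.
Qed.

(** On the line u + t (v + a w) the coefficient of t^m is the value of [h m] at a. *)
Lemma ordat_expansion0 d s q u v w (h : nat -> {poly R}) :
  (forall m, size (h m) <= m.+1)%N -> (forall m, (d < m)%N -> h m = 0) ->
  (forall X Y Z, meval ((X *: u + Y *: v + Z *: w) ord0) q =
        \sum_(m < d.+1) X ^+ (d - m) * binary m (h m) Y Z) ->
  ordat s q u -> forall m, (m < s)%N -> h m = 0.
Proof.
move=> sz z E os m ms; have [dm|md] := ltnP d m; first exact: z.
apply: poly_fun_eq => a; rewrite horner0.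
have linE : lin q u (v + a *: w) = \poly_(k < d.+1) (h k).[a].
  apply: poly_fun_eq => t; rewrite horner_lin horner_poly.
  have -> : u + t *: (v + a *: w) = 1 *: u + (t * 1) *: v + (t * a) *: w.
    by rewrite mulr1 scale1r scalerDr scalerA addrA.
  rewrite E; apply: eq_bigr => k _.
  by rewrite expr1n mul1r binary_scale binary1 // mulrC.
have /dvdp_XnP/(_ _ ms) := os (v + a *: w).
by rewrite linE coef_poly ltnS md.
Qed.

(* Bezout: restricted to the line through u and v, a form of degree d < s + s' with
   these vanishing orders is zero, so the plane can be divided out. *)
Lemma ordat_line d s s' q u v : homogeneous d q -> ordat s q u -> ordat s' q v ->
  ordplane (s + s' - d) q u v.
Proof.
move=> hq os os' X0 Y0 w; have [h [sz z E]] := homogeneous_expansion u v w hq.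
have low m : (m < s)%N -> h m = 0 by exact: ordat_expansion0 E os m.
(* On the line v + t (a u + w) the monomial X^(d-m) Y^(m-j) Z^j becomes a^(d-m) t^(d-m+j), and the
   powers of a separate the values of m. *)
have high m k : (m <= d)%N -> (k < s')%N -> ('X^(d - m) * h m)`_k = 0.
  move=> md ks; move: m md; apply: sum_expr_sub_eq0 => a.
  have linE : lin q v (a *: u + w) =
      \sum_(m < d.+1) a ^+ (d - m) *: ('X^(d - m) * h m).
    apply: poly_fun_eq => t; rewrite horner_lin horner_sum.
    have -> : v + t *: (a *: u + w) = (t * a) *: u + 1 *: v + t *: w.
      by rewrite scale1r scalerDr scalerA addrA [v + _]addrC.
    rewrite E; apply: eq_bigr => m _; rewrite binary1 // hornerZ hornerM hornerXn exprMn; ring.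
  have /dvdp_XnP/(_ _ ks) := os' (a *: u + w).
  by rewrite linE coef_sum; under eq_bigr => m _ do rewrite coefZ.
have -> : lin q (X0 *: u + Y0 *: v) w = \sum_(m < d.+1) X0 ^+ (d - m) *:
    \sum_(j < m.+1) ((h m)`_j * Y0 ^+ (m - j)) *: 'X^j.
  apply: poly_fun_eq => t; rewrite horner_lin E horner_sum; apply: eq_bigr => m _.
  rewrite hornerZ horner_sum; congr (_ * _); apply: eq_bigr => j _.
  by rewrite !hornerE.
elim/big_ind: _ => [|p p' dp dp'|m _]; [exact: dvdp0 | exact: dvdp_add |].
rewrite -mul_polyC dvdp_mull //.
elim/big_ind: _ => [|p p' dp dp'|j _]; [exact: dvdp0 | exact: dvdp_add |].
have [ms|sm] := ltnP m s; first by rewrite low // coef0 mul0r scale0r dvdp0.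
have md : (m <= d)%N by rewrite -ltnS.
have [js|sj] := ltnP (d - m + j) s'.
  have := high m _ md js; rewrite coefXnM ltnNge leq_addr /= addKn => ->.
  by rewrite mul0r scale0r dvdp0.
(* The surviving terms satisfy s <= m and s' <= d - m + j, hence s + s' - d <= j. *)
by rewrite -mul_polyC dvdp_mull // dvdp_exp2l //; lia.
Qed.

(** Going once around the ray of [u], the jumps [q i] sum to zero and each vanishes on its own
    plane. Their parts of degree m < s in the expansion at [u] are multiples of powers of distinct
    binary linear forms, so [powers_independent] kills them. *)
Lemma ordat_pencil (I : finType) d s (n : I -> nat) (c : I -> R)
    (q : I -> mpoly 3 R) u v w :
  (forall x, exists a b e, x = a *: u + b *: v + e *: w) ->
  injective c -> (forall i, homogeneous d (q i)) -> \sum_i q i = 0 ->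
  (forall i X, ordat (n i) (q i) (X *: u + (v + c i *: w))) ->
  (forall m, m < s -> \sum_i (m.+1 - n i) <= m.+1)%N ->
  forall i, ordat s (q i) u.
Proof.
move=> basis c_inj hq q0 on cond.
have [h /all_and3 [sz z E]] :=
  fin_all_exists (fun i => homogeneous_expansion u v w (hq i)).
have h0 m : (m < s)%N -> forall i, h i m = 0.
  move=> ms; have [dm|md] := ltnP d m; first by move=> i; apply: z.
  apply: (powers_independent (m := m) c_inj (n := n)) => //.
  - move=> i.
    (* Translation by [c i] turns the divisibility into the vanishing of low coefficients. *)
    suff /dvdp_comp_poly : 'X^(n i) %| h i m \Po ('X + (c i)%:P).
      move=> /(_ ('X - (c i)%:P)); rewrite -comp_polyA comp_polyD comp_polyX.
      by rewrite comp_polyC subrK comp_polyXr rmorphXn /= comp_polyX.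
    apply/dvdp_XnP => k kn; move: m md {ms}; apply: sum_expr_sub_eq0 => X.
    have linE : lin (q i) (X *: u + (v + c i *: w)) w =
        \sum_(m < d.+1) X ^+ (d - m) *: (h i m \Po ('X + (c i)%:P)).
      apply: poly_fun_eq => t; rewrite horner_lin horner_sum.
      have -> : X *: u + (v + c i *: w) + t *: w = X *: u + 1 *: v + (t + c i) *: w.
        by rewrite scale1r scalerDl -!addrA [t *: w + _]addrC.
      rewrite E; apply: eq_bigr => m _.
      by rewrite binary1 // hornerZ horner_comp !hornerE.
    have /dvdp_XnP/(_ _ kn) := on i X w.
    by rewrite linE coef_sum; under eq_bigr => m _ do rewrite coefZ.
  - apply: poly_fun_eq => a; rewrite horner0 horner_sum.
    move: m md {ms}; apply: sum_expr_sub_eq0 => X.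
    under eq_bigr => m _ do rewrite mulr_sumr.
    rewrite exchange_big /=.
    transitivity (meval ((X *: u + 1 *: v + a *: w) ord0) (\sum_i q i)).
      rewrite raddf_sum; apply: eq_bigr => i _; rewrite /= E.
      by apply: eq_bigr => m _; rewrite binary1.
    by rewrite q0 meval0.
  - exact: cond.
(* Back to the order at [u]: in any direction, the terms with m >= s carry a factor t^m. *)
move=> i x; have [a [b [e ->]]] := basis x.
have -> : lin (q i) u (a *: u + b *: v + e *: w) = \sum_(m < d.+1)
    ((1 + a *: 'X) ^+ (d - m) * (binary m (h i m) b e)%:P) * 'X^m.
  apply: poly_fun_eq => t; rewrite horner_lin horner_sum.
  have -> : u + t *: (a *: u + b *: v + e *: w) =
      (1 + a * t) *: u + (t * b) *: v + (t * e) *: w.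
    by rewrite !scalerDr !scalerA scalerDl scale1r [a * t]mulrC !addrA.
  rewrite E; apply: eq_bigr => m _.
  rewrite binary_scale !hornerM horner_exp hornerXn hornerC !hornerE.
  by rewrite [LHS]mulrAC.
elim/big_ind: _ => [|p p' dp dp'|m _]; [exact: dvdp0 | exact: dvdp_add |].
have [ms|sm] := ltnP m s; first by rewrite h0 // binary0 mulr0 mul0r dvdp0.
by rewrite dvdp_mull // dvdp_exp2l.
Qed.

End Homogeneous.

(** * Generic injectivity *)

Lemma meval_fun_eq0 (R : numFieldType) (q : mpoly 3 R) :
  (forall x : 'rV[R]_3, meval (x ord0) q = 0) -> q = 0.
Proof.
move=> z; pose B := msize q.
(* Kronecker substitution: distinct monomials of q get distinct exponents. *)
pose K := mmap (@polyC R) (fun i : 'I_3 => 'X^(B ^ i)) q.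
have K0 : K = 0.
  apply: poly_fun_eq => t; rewrite horner0 -[RHS](z (\row_i t ^+ (B ^ i))).
  rewrite /K /meval /mmap horner_sum; apply: eq_bigr => m _.
  rewrite hornerCM; congr (_ * _); rewrite /mmap1 horner_prod.
  by apply: eq_bigr => i _; rewrite horner_exp hornerXn mxE.
pose code (m : multinom 3) := (\sum_(i < 3) B ^ i * m i)%N.
have codeX m : mmap1 (fun i : 'I_3 => 'X^(B ^ i) : {poly R}) m = 'X^(code m).
  rewrite /mmap1 /code; elim/big_rec2: _ => [|i a b _ ->]; first by rewrite expr0.
  by rewrite -exprM -exprD.
have bound m i : m \in msupp q -> (m i < B)%N.
  move=> ms; apply: leq_ltn_trans (msize_mdeg_lt ms).
  by rewrite mdegE (bigD1 i) //= leq_addr.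
pose o1 := lift ord0 ord0 : 'I_3; pose o2 := lift ord0 (lift ord0 ord0) : 'I_3.
have codeE m : code m = (m ord0 + B * (m o1 + B * m o2))%N.
  rewrite /code !big_ord_recl big_ord0 expn0 mul1n addn0 mulnDr mulnA.
  by congr (_ + (_ * _ + _ * _))%N; rewrite ?expn1.
have code_inj m m' : m \in msupp q -> m' \in msupp q -> code m = code m' -> m = m'.
  move=> ms ms'; rewrite !codeE => e.
  have digit (a b a' b' : nat) : (a < B -> a' < B -> a + B * b = a' + B * b' ->
      a = a' /\ b = b')%N.
    move=> aB aB' E; have B0 : (0 < B)%N by apply: leq_ltn_trans aB.
    have bb : b = b'.
      have := congr1 (divn^~ B) E.
      by rewrite /= ![(_ + B * _)%N]addnC ![(B * _)%N]mulnC !divnMDl // !divn_small // !addn0.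
    by split=> //; move: E; rewrite bb => /addIn.
  have [e0 {}e] := digit _ _ _ _ (bound _ _ ms) (bound _ _ ms') e.
  have [e1 {}e] := digit _ _ _ _ (bound _ _ ms) (bound _ _ ms') e.
  have [e2 _] : m o2 = m' o2 /\ 0%N = 0%N.
    by apply: digit (bound _ _ ms) (bound _ _ ms') _; rewrite e.
  apply/mnmP => -[[|[|[|//]]] i3].
  - by have -> : Ordinal i3 = ord0 by apply: val_inj.
  - by have -> : Ordinal i3 = o1 by apply: val_inj.
  - by have -> : Ordinal i3 = o2 by apply: val_inj.
apply/mpolyP => m; rewrite mcoeff0; case: (boolP (m \in msupp q)) => [ms|/memN_msupp_eq0 //].
have := congr1 (fun p : {poly R} => p`_(code m)) K0.
rewrite /K /mmap coef0 coef_sum (bigD1_seq m) //= coefCM codeX coefXn eqxx mulr1.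
rewrite big_seq_cond big1 ?addr0 // => m' /andP [ms' ne].
rewrite coefCM codeX coefXn; case: eqP => [e|_]; last by rewrite mulr0.
by rewrite (code_inj _ _ ms ms' e) eqxx in ne.
Qed.

Section Rank.
Variables (K : fieldType) (N : nat) (X : Type).

(** Greedy choice from a possibly infinite family: while fewer than N rows are chosen their cokernel
    is nonzero, so some member lies outside their span. *)
Lemma unitmx_of_family (a : X -> 'rV[K]_N) :
  (forall c : 'cV[K]_N, (forall x, a x *m c = 0) -> c = 0) ->
  exists s : 'I_N -> X, \matrix_i a (s i) \in unitmx.
Proof.
move=> inj.
suff H k : (k <= N)%N -> exists s : 'I_k -> X, row_free (\matrix_i a (s i)).
  by have [s sf] := H N (leqnn N); exists s; rewrite -row_free_unit.
elim: k => [|k IH] kN.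
  have f0 : 'I_0 -> X by case.
  by exists f0; rewrite -row_leq_rank.
have [s sf] := IH (ltnW kN); set M := \matrix_i a (s i) in sf.
have [x nx] : exists x, a x *m cokermx M != 0.
  apply: contrapT => none; have : cokermx M = 0.
    apply/matrixP => i j.
    have /matrixP/(_ i 0) : col j (cokermx M) = 0.
      apply: inj => x; rewrite colE mulmxA.
      have [-> |nz] := eqVneq (a x *m cokermx M) 0; last by case: none; exists x.
      by rewrite mul0mx.
    by rewrite !mxE.
  move=> c0; have := mxrank_coker M; rewrite c0 mxrank0.
  by move: sf; rewrite /row_free => /eqP ->; lia.
have rf : row_free (col_mx M (a x)).
  apply: inj_row_free => v; rewrite -[v]hsubmxK mul_row_col => v0.
  have : (lsubmx v *m M + rsubmx v *m a x) *m cokermx M = 0 by rewrite v0 mul0mx.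
  rewrite mulmxDl -mulmxA mulmx_coker mulmx0 add0r -mulmxA.
  rewrite [rsubmx v]mx11_scalar mul_scalar_mx => /eqP.
  rewrite scaler_eq0 (negbTE nx) orbF => /eqP r0.
  move: v0; rewrite [rsubmx v]mx11_scalar r0 mul_scalar_mx scale0r addr0 => l0.
  have /(row_free_inj sf) -> : lsubmx v *m M = 0 *m M by rewrite mul0mx.
  by rewrite mxE mul0rn raddf0 row_mx0.
have castf (m m' : nat) (e : m = m') (A : 'M[K]_(m, N)) :
  row_free (castmx (e, erefl) A) = row_free A by case: _ / e.
have eqk : (k + 1)%N = k.+1 by rewrite addn1.
exists (fun i => match fintype.split (cast_ord (esym eqk) i) with inl j => s j | inr _ => x end).
suff -> : \matrix_i a (match fintype.split (cast_ord (esym eqk) i) with inl j => s j | inr _ => x end)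
  = castmx (eqk, erefl) (col_mx M (a x)) by rewrite castf.
apply/matrixP => i j; rewrite castmxE !mxE cast_ord_id.
by case: (fintype.split _) => l; rewrite ?mxE // ord1.
Qed.
End Rank.

(** D is the determinant of N rows that are independent at [t0]; wherever it is nonzero these rows
    alone force c = 0. *)
Lemma generic_injectivity (R : numFieldType) (N : nat) (X : Type)
    (a : X -> 'rV[{poly R}]_N) (t0 : R) :
  (forall c : 'cV[R]_N, (forall x, map_mx (horner_eval t0) (a x) *m c = 0) -> c = 0) ->
  exists2 D : {poly R}, D != 0 & forall t, D.[t] != 0 ->
    forall c : 'cV[R]_N, (forall x, map_mx (horner_eval t) (a x) *m c = 0) -> c = 0.
Proof.
move=> /unitmx_of_family [s su]; pose M := \matrix_i a (s i).
have ME t : \matrix_i map_mx (horner_eval t) (a (s i)) = map_mx (horner_eval t) M.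
  by apply/matrixP => i j; rewrite !mxE.
exists (\det M).
  move: su; rewrite ME unitmxE det_map_mx unitfE; apply: contraNneq => ->.
  by rewrite rmorph0.
move=> t Dt c c0; have Mu : map_mx (horner_eval t) M \in unitmx.
  by rewrite unitmxE det_map_mx unitfE.
rewrite -(mulKmx Mu c) (_ : map_mx _ M *m c = 0) ?mulmx0 // -ME.
apply/row_matrixP => i; rewrite row_mul rowK c0.
by apply/matrixP => k l; rewrite !mxE.
Qed.

Lemma homogeneous_basis (R : realType) (d : nat) :
  exists b : 'I_('C(d + 2, 2)) -> mpoly 3 R,
    [/\ forall j, homogeneous d (b j),
        forall q, homogeneous d q -> exists c, q = \sum_j c j *: b j &
        forall c, \sum_j c j *: b j = 0 -> forall j, c j = 0].
Proof.
pose s := [seq s2m t | t : d.-tuple 'I_3 <- enum (basis 3 d)].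
have ss : size s = 'C(d + 2, 2) by rewrite size_basis -[RHS]bin_sub ?addnK // leq_addl.
pose M (j : 'I_('C(d + 2, 2))) := nth (@mnm0 3) s j.
have Ms j : M j \in s by rewrite mem_nth // ss.
have M_inj : injective M.
  move=> i j /eqP; rewrite nth_uniq ?ss ?uniq_basis // => /eqP; exact: val_inj.
have coefE (c : 'I_('C(d + 2, 2)) -> R) m :
    mcoeff m (\sum_j c j *: mpolyX R (M j)) = \sum_j c j * (M j == m)%:R.
  by rewrite raddf_sum; apply: eq_bigr => j _ /=; rewrite mcoeffZ mcoeffX.
have coefM (c : 'I_('C(d + 2, 2)) -> R) j :
    mcoeff (M j) (\sum_j c j *: mpolyX R (M j)) = c j.
  rewrite coefE (bigD1 j) //= eqxx mulr1 big1 ?addr0 // => i ij.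
  by rewrite (inj_eq M_inj) (negbTE ij) mulr0.
exists (fun j => mpolyX R (M j)); split.
- by move=> j; rewrite /homogeneous dhomogX basis_cover.
- move=> q hq; exists (fun j => mcoeff (M j) q); apply/mpolyP => m.
  case: (boolP (m \in s)) => [ms|nms].
    have mi : (index m s < 'C(d + 2, 2))%N by rewrite -ss index_mem.
    have -> : m = M (Ordinal mi) by rewrite /M nth_index.
    by rewrite coefM.
  rewrite coefE big1 => [|j _]; last first.
    by case: eqP => [e|_]; [rewrite -e Ms in nms | rewrite mulr0].
  by apply: (dhomog_nemf_coeff hq); rewrite basis_cover.
- by move=> c c0 j; rewrite -[LHS](coefM c) c0 mcoeff0.
Qed.

Section GenericLine.
Variable R : realType.

(** [lin] at a base point that moves with a parameter: the outer variable runs along the line, the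
    inner one is the parameter. *)
Definition gen_lin (q : mpoly 3 R) (x : 'rV[{poly R}]_3) (w : 'rV[R]_3) :
    {poly {poly R}} :=
  mmap (polyC \o polyC) (fun i => (x ord0 i)%:P + ((w ord0 i)%:P)%:P * 'X) q.

Lemma gen_linE t q x w k :
  ((gen_lin q x w)`_k).[t] = (lin q (map_mx (horner_eval t) x) w)`_k.
Proof.
have -> : lin q (map_mx (horner_eval t) x) w = map_poly (horner_eval t) (gen_lin q x w).
  rewrite /gen_lin /lin /mmap rmorph_sum; apply: eq_bigr => m _ /=.
  rewrite rmorphM /= map_polyC /= [horner_eval t _]hornerC; congr (_ * _).
  rewrite /mmap1 rmorph_prod; apply: eq_bigr => i _.
  rewrite rmorphXn rmorphD rmorphM /= !map_polyC map_polyX /= !mxE.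
  by rewrite [horner_eval t _%:P]hornerC.
by rewrite coef_map.
Qed.
End GenericLine.

(** * Rigidity as a linear system with polynomial entries *)

Section Rigid.
Variables (R : realType) (V : finType) (Delta : {set {set V}}) (gamma : V).
Local Notation E := 'rV[R]_3.

Definition tet (u v a : V) : {set V} := [set gamma; u; v; a]%SET.

Definition is_tet u v a := tet u v a \in tetrahedra Delta.

(* A u v and B u v span the plane of the triangle {gamma, u, v}. *)
Definition smooth (n : nat) (A B : V -> V -> E) (q : {set V} -> mpoly 3 R) :=
  forall u v a b, is_tet u v a -> is_tet u v b ->
    ordplane n (q (tet u v a) - q (tet u v b)) (A u v) (B u v).

(** Only global polynomials have contact of order n across all triangles. Planes are given by
    vectors indexed by pairs, not by vertex positions, so that limits of planes under collapsing
    vertices are covered. *)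
Definition rigid (n d : nat) (A B : V -> V -> E) :=
  forall q : {set V} -> mpoly 3 R,
    (forall T, homogeneous d (q T)) -> smooth n A B q ->
    forall S T, S \in tetrahedra Delta -> T \in tetrahedra Delta -> q S = q T.

Definition eval_at (t : R) (A : V -> V -> 'rV[{poly R}]_3) u v : E :=
  map_mx (horner_eval t) (A u v).

(** After subtracting the polynomial on one tetrahedron [T0], rigidity says that a linear system in
    the coefficients of the [q T] has only the zero solution. Its entries are polynomials in the
    parameter, so [generic_injectivity] applies. *)
Lemma rigid_generic n d (A B : V -> V -> 'rV[{poly R}]_3) t0 :
  rigid n d (eval_at t0 A) (eval_at t0 B) ->
  exists2 D : {poly R}, D != 0 & forall t, D.[t] != 0 ->
    rigid n d (eval_at t A) (eval_at t B).
Proof.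
move=> rig0.
have [T0 T0t|noT] := pickP [in tetrahedra Delta]; last first.
  by exists 1; [exact: oner_neq0 | move=> t _ q _ _ S T; have := noT S => /= ->].
have [b [bh bspan bfree]] := homogeneous_basis R d.
pose I : finType := ({set V} * 'I_('C(d + 2, 2)))%type.
(* One equation per pair of tetrahedra on a triangle, point of the plane, direction and coefficient
   below n. The index type is infinite. *)
pose W := (V * V * V * V * R * R * E * nat)%type.
pose guard (x : W) := let: (u, v, a, b, _, _, _, k) := x in
  [&& is_tet u v a, is_tet u v b & (k < n)%N].
pose wall (x : W) T (p : mpoly 3 R) : {poly R} := let: (u, v, a, b, X, Y, w, k) := x in
  ((T == tet u v a)%:R - (T == tet u v b)%:R) *
  (gen_lin p (X%:P *: A u v + Y%:P *: B u v) w)`_k.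
(* These equations normalize solutions: zero on [T0] and on all sets that are not tetrahedra. *)
pose fixed (x : {set V} * E) T (p : mpoly 3 R) : {poly R} :=
  if (x.1 \notin tetrahedra Delta) || (x.1 == T0)
  then (T == x.1)%:R * (meval (x.2 ord0) p)%:P else 0.
pose F (x : W + ({set V} * E)) T p : {poly R} := match x with
  | inl y => if guard y then wall y T p else 0 | inr y => fixed y T p end.
pose a x : 'rV[{poly R}]_#|I| := \row_i F x (enum_val i).1 (b (enum_val i).2).
pose qc (c : 'cV[R]_#|I|) T := \sum_j c (enum_rank ((T, j) : I)) 0 *: b j.
have qch c T : homogeneous d (qc c T).
  by rewrite /homogeneous rpred_sum // => j _; apply/rpredZ/bh.
have aE t x c : (map_mx (horner_eval t) (a x) *m c) 0 0 =
    \sum_T \sum_j c (enum_rank ((T, j) : I)) 0 * (F x T (b j)).[t].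
  rewrite mxE (reindex_onto enum_rank enum_val) => [|i _]; last exact: enum_valK.
  rewrite (eq_bigl predT) => [|i]; last by rewrite enum_rankK eqxx.
  rewrite pair_big /=; apply: eq_bigr => -[T j] _.
  by rewrite !mxE enum_rankK mulrC.
have fixedE t y c : (map_mx (horner_eval t) (a (inr y)) *m c) 0 0 =
    if (y.1 \notin tetrahedra Delta) || (y.1 == T0)
    then meval (y.2 ord0) (qc c y.1) else 0.
  rewrite aE /= /fixed; case: ifP => _; last first.
    by rewrite big1 // => T _; rewrite big1 // => j _; rewrite horner0 mulr0.
  rewrite (bigD1 y.1) //= [X in _ + X]big1 ?addr0 => [|T /negbTE ne]; last first.
    by rewrite big1 // => j _; rewrite ne mul0r horner0 mulr0.
  rewrite raddf_sum; apply: eq_bigr => j _ /=.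
  by rewrite eqxx mul1r hornerC mevalZ.
have wallE t y c : (map_mx (horner_eval t) (a (inl y)) *m c) 0 0 =
    if guard y then let: (u, v, a, b, X, Y, w, k) := y in
      (lin (qc c (tet u v a) - qc c (tet u v b))
        (X *: eval_at t A u v + Y *: eval_at t B u v) w)`_k else 0.
  rewrite aE /=; case: ifP => _; last first.
    by rewrite big1 // => T _; rewrite big1 // => j _; rewrite horner0 mulr0.
  case: y => [[[[[[[u v] e] f] X] Y] w] k] /=.
  have xE : map_mx (horner_eval t) (X%:P *: A u v + Y%:P *: B u v) =
      X *: eval_at t A u v + Y *: eval_at t B u v.
    by rewrite map_mxD !map_mxZ /= /horner_eval !hornerC.
  have sumE S : \sum_T \sum_j c (enum_rank ((T, j) : I)) 0 *
      ((T == S)%:R * (lin (b j) (X *: eval_at t A u v + Y *: eval_at t B u v) w)`_k) =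
      (lin (qc c S) (X *: eval_at t A u v + Y *: eval_at t B u v) w)`_k.
    rewrite (bigD1 S) //= [X in _ + X]big1 ?addr0 => [|T /negbTE ne]; last first.
      by rewrite big1 // => j _; rewrite ne mul0r mulr0.
    rewrite lin_sum coef_sum; apply: eq_bigr => j _.
    by rewrite eqxx mul1r linZ coefZ.
  rewrite linB coefB -!sumE -sumrB; apply: eq_bigr => T _.
  rewrite -sumrB; apply: eq_bigr => j _.
  rewrite -mulrBr -mulrBl hornerM gen_linE xE; congr (_ * (_ * _)).
  by rewrite hornerD hornerN -!polyC_natr !hornerC.
have kernel t c : (forall x, map_mx (horner_eval t) (a x) *m c = 0) <->
    smooth n (eval_at t A) (eval_at t B) (qc c) /\
    forall T, (T \notin tetrahedra Delta) || (T == T0) -> qc c T = 0.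
  split=> [c0|[sm z] x].
    split=> [u v e f ue uf X Y w|T Tz].
      apply/dvdp_XnP => k kn; have := wallE t (u, v, e, f, X, Y, w, k) c.
      by rewrite c0 mxE /= ue uf kn.
    apply: meval_fun_eq0 => x; have := fixedE t (T, x) c.
    by rewrite c0 mxE /= Tz.
  apply/matrixP => i j; rewrite !ord1 [RHS]mxE; case: x => y; last first.
    by rewrite fixedE; case: ifP => // /z ->; rewrite meval0.
  rewrite wallE; case: ifP => //; case: y => [[[[[[[u v] e] f] X] Y] w] k] /=.
  by case/and3P => ue uf kn; have /dvdp_XnP := sm _ _ _ _ ue uf X Y w; apply.
have zero (q : {set V} -> mpoly 3 R) : (forall T, (T \notin tetrahedra Delta) || (T == T0) -> q T = 0) ->
   (forall S T, S \in tetrahedra Delta -> T \in tetrahedra Delta -> q S = q T) -> forall T, q T = 0.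
  move=> z r T; case: (boolP (T \in tetrahedra Delta)) => Tt; last by apply: z; rewrite Tt.
  by rewrite (r T T0 Tt T0t) z // eqxx orbT.
have [|D D0 HD] := @generic_injectivity R _ _ a t0.
  move=> c /kernel [sm z].
  have q0 : forall T, qc c T = 0 by apply: zero z _; apply: rig0 => //.
  apply/matrixP => i k; rewrite ord1 [RHS]mxE -[i]enum_valK.
  by case: (enum_val i) => T j; apply: (bfree (fun j => c (enum_rank ((T, j) : I)) 0)); apply: q0.
exists D => // t Dt q hq sm S T St Tt.
pose q' T := if T \in tetrahedra Delta then q T - q T0 else 0.
have [c cE] : exists c, forall T, q' T = qc c T.
  have q'h U : homogeneous d (q' U).
    rewrite /q' /homogeneous; case: ifP => _; last exact: rpred0.
    by apply: rpredB; apply: hq.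
  have [c cE] := fin_all_exists (fun U => bspan _ (q'h U)).
  exists (\col_i c (enum_val i).1 (enum_val i).2) => U; rewrite cE.
  by apply: eq_bigr => j _; rewrite mxE enum_rankK.
have c0 : c = 0.
  apply: (HD t Dt); apply/kernel; split.
    move=> u v e f ue uf; rewrite -!cE /q'.
    by move: (ue) (uf); rewrite /is_tet => -> ->; rewrite opprB addrA subrK; apply: sm.
  by move=> U; rewrite -cE /q'; case: ifP => //= _ /eqP ->; rewrite subrr.
have q'0 U : q' U = 0.
  by rewrite cE c0 /qc big1 // => j _; rewrite mxE scale0r.
have := q'0 S; have := q'0 T; rewrite /q' St Tt => /eqP; rewrite subr_eq0 => /eqP ->.
by move/eqP; rewrite subr_eq0 => /eqP.
Qed.
End Rigid.

(** * The link of the center *)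

Section Link.
Variables (V : finType) (Delta : {set {set V}}) (gamma : V).
Local Notation tet := (tet gamma).
Local Notation is_tet := (is_tet Delta gamma).

Lemma tetCA u v a : tet u v a = tet v u a.
Proof. by apply/setP => x; rewrite !inE -!orbA; do !bool_congr. Qed.

Lemma tetAC u v a : tet u v a = tet u a v.
Proof. by apply/setP => x; rewrite !inE -!orbA; do !bool_congr. Qed.

Lemma is_tetCA u v a : is_tet u v a = is_tet v u a.
Proof. by rewrite /is_tet tetCA. Qed.

Lemma is_tetAC u v a : is_tet u v a = is_tet u a v.
Proof. by rewrite /is_tet tetAC. Qed.

Lemma is_tet_uniq u v a : is_tet u v a -> uniq [:: gamma; u; v; a].
Proof.
rewrite /is_tet inE => /andP [_ /eqP c4]; apply/card_uniqP; rewrite -[RHS]c4.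
by apply: eq_card => x; rewrite !inE -!orbA.
Qed.

Lemma is_tet_neq u v a : is_tet u v a ->
  [/\ u != gamma, v != gamma & a != gamma] /\ [/\ u != v, u != a & v != a].
Proof.
move/is_tet_uniq; rewrite /= !inE !negb_or andbT.
by case/and3P => /and3P [gu gv ga] /andP [uv ua] va; rewrite ![_ == gamma]eq_sym.
Qed.

(** Without [gamma], the tetrahedra are the triangles of the link. It is a closed surface: each edge
    lies in exactly two triangles. [link_hereditary] gives connectedness of the surface, taken at
    [gamma], and of its vertex links, taken at other vertices. *)
Record closed_link : Prop := ClosedLink {
  link_center : forall T, T \in tetrahedra Delta -> gamma \in T;
  link_hereditary : hereditary Delta;
  link_two : forall u v a, is_tet u v a -> exists b,
    [/\ b != a, is_tet u v b & forall c, is_tet u v c -> c = a \/ c = b];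
  link_cover : forall v, v != gamma -> exists2 T, T \in tetrahedra Delta & v \in T
}.

Lemma tet_of_edge T u v :
  (forall T, T \in tetrahedra Delta -> gamma \in T) ->
  T \in tetrahedra Delta -> u \in T -> v \in T ->
  u != v -> u != gamma -> v != gamma -> exists a, T = tet u v a.
Proof.
move=> HC Tt uT vT uv ug vg; have gT := HC _ Tt.
have : #|T :\ gamma :\ u :\ v| == 1%N.
  have := Tt; rewrite inE => /andP [_].
  rewrite (cardsD1 gamma T) gT (cardsD1 u (T :\ gamma)) !inE ug uT.
  by rewrite (cardsD1 v (T :\ gamma :\ u)) !inE (eq_sym v) uv vg vT /=.
case/cards1P => a aE; exists a; apply/setP => x; rewrite !inE.
have := congr1 (fun A : {set V} => x \in A) aE; rewrite /= !inE.
case: (eqVneq x v) => [-> _|_]; first by rewrite vT orbT.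
case: (eqVneq x u) => [-> _|_]; first by rewrite uT orbT.
by case: (eqVneq x gamma) => [-> _|_] //=.
Qed.

Lemma tet_of_vertex T u :
  (forall T, T \in tetrahedra Delta -> gamma \in T) ->
  T \in tetrahedra Delta -> u \in T -> u != gamma ->
  exists x y, T = tet u x y.
Proof.
move=> HC Tt uT ug; have gT := HC _ Tt.
have /card_gt0P [v] : (0 < #|T :\ gamma :\ u|)%N.
  have := Tt; rewrite inE => /andP [_].
  by rewrite (cardsD1 gamma T) gT (cardsD1 u (T :\ gamma)) !inE ug uT /=; lia.
rewrite !inE => /and3P [vu vg vT]; exists v.
by apply: (tet_of_edge HC) => //; rewrite eq_sym.
Qed.

Hypothesis HL : closed_link.

Lemma shared_edge S T : S \in tetrahedra Delta -> T \in tetrahedra Delta ->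
  #|S :&: T|%SET == 3%N -> exists u v a b,
  [/\ S = tet u v a & T = tet u v b].
Proof.
move=> St Tt /eqP c3; have gS := link_center HL St; have gT := link_center HL Tt.
have : #|(S :&: T) :\ gamma| == 2%N.
  by move: c3; rewrite (cardsD1 gamma) inE gS gT /= add1n => -[->].
move=> /cards2P [u [v [uv E]]].
have : u \in (S :&: T) :\ gamma by rewrite E !inE eqxx.
have : v \in (S :&: T) :\ gamma by rewrite E !inE eqxx orbT.
rewrite !inE => /and3P [vg vS vT] /and3P [ug uS uT].
have [a Sa] := tet_of_edge (link_center HL) St uS vS uv ug vg.
have [b Tb] := tet_of_edge (link_center HL) Tt uT vT uv ug vg.
by exists u, v, a, b.
Qed.

Lemma shared_edge_at S T u : S \in tetrahedra Delta -> T \in tetrahedra Delta ->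
  u \in S -> u \in T -> u != gamma -> #|S :&: T|%SET == 3%N ->
  exists v a b, S = tet u v a /\ T = tet u v b.
Proof.
move=> St Tt uS uT ug c3; have [x [y [a [b [SE TE]]]]] := shared_edge St Tt c3.
have [ux|ux] := eqVneq u x; first by rewrite ux; exists y, a, b.
have /is_tet_neq [[xg _ _] _] : is_tet x y a by rewrite /is_tet -SE.
have xS : x \in S by rewrite SE !inE eqxx ?orbT.
have xT : x \in T by rewrite TE !inE eqxx ?orbT.
have [a' Sa] := tet_of_edge (link_center HL) St uS xS ux ug xg.
have [b' Tb] := tet_of_edge (link_center HL) Tt uT xT ux ug xg.
by exists x, a', b'.
Qed.

(** The chain of tetrahedra around [u] given by [hereditary] carries [P] along. *)
Lemma star_path_ind u (P : {set V} -> Prop) S :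
  u != gamma -> S \in tetrahedra Delta -> u \in S -> P S ->
  (forall v a b, is_tet u v a -> is_tet u v b -> P (tet u v b) -> P (tet u v a)) ->
  forall T, T \in tetrahedra Delta -> u \in T -> P T.
Proof.
move=> ug St uS PS step T Tt uT.
have /connectP [p] := link_hereditary HL Tt St uT uS.
elim: p T Tt uT => [|T' p IH] T Tt uT /=; first by move=> _ <-.
case/andP => /and5P [_ T't _ uT' c3] pth lst.
have [v [a [b [TE T'E]]]] := shared_edge_at Tt T't uT uT' ug c3.
rewrite TE; apply: (step v a b); rewrite /is_tet -?TE -?T'E //.
exact: IH pth lst.
Qed.

(** The same with the chain around [gamma], which reaches every tetrahedron. *)
Lemma all_path_ind (P : {set V} -> Prop) S :
  S \in tetrahedra Delta -> P S ->
  (forall u v a b, is_tet u v a -> is_tet u v b -> P (tet u v b) -> P (tet u v a)) ->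
  forall T, T \in tetrahedra Delta -> P T.
Proof.
move=> St PS step T Tt; have gS := link_center HL St; have gT := link_center HL Tt.
have /connectP [p] := link_hereditary HL Tt St gT gS.
elim: p T Tt {gT} => [|T' p IH] T Tt /=; first by move=> _ <-.
case/andP => /and5P [_ T't _ _ c3] pth lst.
have [u [v [a [b [TE T'E]]]]] := shared_edge Tt T't c3.
rewrite TE; apply: (step u v a b); rewrite /is_tet -?TE -?T'E //.
exact: IH pth lst.
Qed.

Definition nbr u v := [exists a, is_tet u v a].

Lemma nbrP u v : reflect (exists a, is_tet u v a) (nbr u v).
Proof. exact: existsP. Qed.

Lemma is_tet_nbr u v a : is_tet u v a -> nbr u v.
Proof. by move=> t; apply/nbrP; exists a. Qed.

Lemma nbrC u v : nbr u v = nbr v u.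
Proof. by apply/nbrP/nbrP => -[a]; rewrite is_tetCA; exists a. Qed.

Lemma nbr_neq u v : nbr u v -> [/\ u != v, u != gamma & v != gamma].
Proof.
by case/nbrP => a /is_tet_neq [[-> -> _] [-> _ _]].
Qed.

(** [is_tet u] is the edge relation of the link of [u] in the surface; a chain of tetrahedra around
    [u] traces a path in this graph. *)
Lemma link_connected u x y : nbr u x -> nbr u y -> connect (is_tet u) x y.
Proof.
case/nbrP => a ta /nbrP [b tb]; have [_ ug _] := nbr_neq (is_tet_nbr ta).
pose P (T : {set V}) := forall z e, T = tet u z e -> is_tet u z e -> connect (is_tet u) z y.
suff : P (tet u x a) by apply.
have mem v w : u \in tet u v w by rewrite !inE eqxx !orbT.
have at_edge z e z' e' : tet u z e = tet u z' e' -> is_tet u z e ->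
    connect (is_tet u) z z'.
  move=> E t; have : z \in tet u z' e' by rewrite -E !inE eqxx !orbT.
  have [[_ zg _] [uz _ _]] := is_tet_neq t.
  rewrite !inE (negbTE zg) (eq_sym z u) (negbTE uz) /= => /orP [/eqP -> //|/eqP ->].
  by apply: connect1; move: t; rewrite /is_tet E tetAC.
apply: (@star_path_ind u P (tet u y b) ug tb (mem _ _)) (ta) (mem _ _).
  by move=> z e E; apply: at_edge (esym E).
move=> v e f te tf Pf z g E tz.
by apply: connect_trans (at_edge _ _ _ _ (esym E) tz) (Pf _ _ erefl tf).
Qed.

(** The handshake lemma: ordering each pair by [enum_rank] shows that every edge is counted
    twice. *)
Lemma even_symmetric (e : rel V) (C : {set V}) :
  ssrbool.symmetric e -> irreflexive e ->
  ~~ odd (\sum_(x in C) #|[set y in C | e x y]|).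
Proof.
move=> es ei.
pose f x y := ((x \in C) && (y \in C) && e x y : nat).
have -> : (\sum_(x in C) #|[set y in C | e x y]| = \sum_x \sum_y f x y)%N.
  rewrite big_mkcond; apply: eq_bigr => x _; case: ifP => xC; last first.
    by rewrite big1 // => y _; rewrite /f xC.
  rewrite -sum1_card big_mkcond; apply: eq_bigr => y _.
  by rewrite /f !inE xC; case: ifP.
have fs x y : f x y = f y x by rewrite /f es [(x \in C) && _]andbC.
have split : (\sum_x \sum_y f x y =
   \sum_x \sum_(y | enum_rank x < enum_rank y) f x y +
   \sum_x \sum_(y | enum_rank y < enum_rank x) f x y)%N.
  rewrite -big_split; apply: eq_bigr => x _ /=.
  rewrite (bigD1 x) //= {1}/f ei andbF add0n (bigID (fun y => enum_rank x < enum_rank y)%N) /=.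
  congr (_ + _)%N; apply: eq_bigl => y.
    by case: (eqVneq y x) => [->|]; rewrite ?ltnn.
  have [->|ne] := eqVneq y x; first by rewrite ltnn.
  rewrite -leqNgt leq_eqVlt; case: eqP => //= e0.
  by case/eqP: ne; apply/enum_rank_inj/val_inj.
rewrite split [X in (_ + X)%N](_ : _ = \sum_x \sum_(y | enum_rank x < enum_rank y) f x y)%N.
  by rewrite addnn odd_double.
rewrite (exchange_big_dep predT) //=; apply: eq_bigr => y _.
by apply: eq_bigr => x _.
Qed.

(* Parity: all degrees in the link of u are two, so a component of the link minus a
   is joined to a by an even number of edges. *)
Lemma link_minus_connected u a x y :
  is_tet u a x -> nbr u y -> y != a ->
  connect [rel z w | [&& is_tet u z w, z != a & w != a]] x y.
Proof.
move=> tax uy ya; set e' := [rel z w | _].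
have eC z w : is_tet u z w = is_tet u w z by rewrite is_tetAC.
have [_ ug ag] := nbr_neq (is_tet_nbr tax).
have [_ [_ _ ax]] := is_tet_neq tax.
pose C := [set z | connect e' x z].
have Cx : x \in C by rewrite inE.
have Ca z : z \in C -> z != a.
  rewrite inE => /connectP [p]; case/lastP: p => [_ ->|p w]; first by rewrite eq_sym.
  by rewrite last_rcons rcons_path => /andP [_ /and3P [_ _ ?]] ->.
have Cclosed z w : z \in C -> is_tet u z w -> w != a -> w \in C.
  move=> zC t wa; move: (zC); rewrite !inE => xz.
  by apply: connect_trans xz (connect1 _); rewrite /= t (Ca _ zC).
have Cnbr z : z \in C -> nbr u z.
  rewrite inE => /connectP [p]; case/lastP: p => [_ ->|p w].
    by apply/nbrP; exists a; rewrite eC.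
  rewrite last_rcons rcons_path => /andP [_ /and3P [t _ _]] ->.
  by apply: (@is_tet_nbr _ _ (last x p)); rewrite eC.
have deg2 z : z \in C -> #|[set w | is_tet u z w]| = 2%N.
  move=> /Cnbr /nbrP [w t]; have [b [bw tb uq]] := link_two HL t.
  have -> : [set w | is_tet u z w] = [set w; b].
    apply/setP => v; rewrite !inE; apply/idP/orP => [/uq [] ->|[/eqP -> //|/eqP ->]//].
      by left.
    by right.
  by rewrite cards2 eq_sym bw.
have degC z : z \in C -> (#|[set w in C | is_tet u z w]| + is_tet u z a = 2)%N.
  move=> zC; rewrite -(deg2 z zC) (cardsD1 a [set w | is_tet u z w]) inE addnC; congr (_ + _)%N.
  apply: eq_card => w; rewrite !inE -[connect _ _ _](finset.in_set (fun w => connect e' x w)).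
  apply/andP/andP => -[h t]; split=> //; first exact: Ca.
  exact: Cclosed zC t h.
have := even_symmetric C eC (fun z => _ : is_tet u z z = false); rewrite -/e'.
have irr z : is_tet u z z = false.
  by apply/negP => /is_tet_uniq; rewrite /= !inE eqxx !(andbF, orbT).
move=> /(_ irr) ev.
have ev2 : ~~ odd (\sum_(z in C) is_tet u z a).
  have : (\sum_(z in C) (#|[set w in C | is_tet u z w]| + is_tet u z a) = 2 * #|C|)%N.
    by rewrite (eq_bigr (fun=> 2)%N) ?sum_nat_const 1?mulnC.
  rewrite big_split /= => E; have := congr1 odd E.
  by rewrite oddD oddM /= (negbTE ev) /= => ->.
have [b [bx tb uq]] := link_two HL tax.
(* Otherwise [x] would be the only vertex of the component joined to [a], an odd number of edges. *)
have Cb : b \in C.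
  apply: contraNT ev2 => nb; rewrite (bigD1 x) //= eC tax big1 // => z /andP [zC zx].
  case: (boolP (is_tet u z a)) => // t; rewrite eC in t.
  by case: (uq z t) => E; [rewrite E eqxx in zx | rewrite -E zC in nb].
(* Together with [a] the component is closed under adjacency, hence is the whole link of [u]. *)
have closedCa z w : (z \in a |: C) -> is_tet u z w -> w \in a |: C.
  rewrite !inE; have [->|wa] //= := eqVneq w a.
  case/orP => [/eqP -> t|zC t].
    by case: (uq w t) => ->; [move: Cx | move: Cb]; rewrite inE.
  by have := @Cclosed z w; rewrite !inE; apply.
have : y \in a |: C.
  have /connectP [p] := link_connected (is_tet_nbr tax) uy.
  set A := a |: C in closedCa *.
  have : a \in A by rewrite !inE eqxx.
  elim: p (a) => [|w p IH] z zC /=; first by move=> _ ->.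
  by case/andP => t; apply: IH; apply: closedCa zC t.
by rewrite !inE (negbTE ya).
Qed.

(** All degrees in the link of [u] are two, so a 3-cycle is a component, and the link is
    connected. *)
Lemma link_triangle u x y z w :
  is_tet u x y -> is_tet u y z -> is_tet u x z -> nbr u w -> w \in [:: x; y; z].
Proof.
move=> xy yz xz uw; have eC a b : is_tet u a b = is_tet u b a by rewrite is_tetAC.
have only a b c v : is_tet u a b -> is_tet u a c -> b != c -> is_tet u a v -> v \in [:: b; c].
  move=> ab ac bc av; have [e [_ _ uq]] := link_two HL ab.
  have ce : c = e by case: (uq c ac) => // cb; rewrite cb eqxx in bc.
  by case: (uq v av) => ->; rewrite !inE -?ce eqxx ?orbT.
have [xyn xzn yzn] : [/\ x != y, x != z & y != z].
  by split; [case: (is_tet_neq xy) | case: (is_tet_neq xz) | case: (is_tet_neq yz)] => _ [].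
have /connectP [p] := link_connected (is_tet_nbr xy) uw.
have : x \in [:: x; y; z] by rewrite inE eqxx.
elim: p {1 3 4}x => [|v p IH] t tx /=; first by move=> _ ->.
case/andP => tv; apply: IH; move: tx tv; rewrite inE => /orP [/eqP ->|].
  by move=> /(only _ _ _ _ xy xz yzn); rewrite !inE => ->; rewrite orbT.
rewrite inE => /orP [/eqP ->|].
  by rewrite eC in xy => /(only _ _ _ _ xy yz xzn); rewrite !inE => /orP [] ->; rewrite ?orbT.
rewrite inE => /eqP ->; rewrite eC in xz; rewrite eC in yz.
by move=> /(only _ _ _ _ xz yz xyn); rewrite !inE => /orP [] ->; rewrite ?orbT.
Qed.

Lemma tet_exists : (1 < #|V|)%N -> exists u v a, is_tet u v a.
Proof.
move=> V1; have /card_gt0P [v] : (0 < #|[set~ gamma]|)%N by rewrite cardsC1; lia.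
rewrite !inE => vg; have [T Tt vT] := link_cover HL vg.
have [x [y TE]] := tet_of_vertex (link_center HL) Tt vT vg.
by exists v, x, y; rewrite /is_tet -TE.
Qed.

Lemma nbr_exists u : u != gamma -> exists v a, is_tet u v a.
Proof.
move=> ug; have [T Tt uT] := link_cover HL ug.
by have [x [y TE]] := tet_of_vertex (link_center HL) Tt uT ug; exists x, y; rewrite /is_tet -TE.
Qed.

(** While a vertex is missing, some triangle has two vertices in the list and its third outside, and
    this third one is appended. Otherwise chains of tetrahedra starting inside the list could never
    leave it. *)
Lemma shelling_order : (3 < #|V|)%N -> exists s : seq V,
  [/\ uniq s, s =i predC1 gamma,
      exists a, is_tet (nth gamma s 0) (nth gamma s 1) a &
      forall k, (1 < k < size s)%N -> exists i j,
        [/\ (i < k)%N, (j < k)%N & is_tet (nth gamma s k) (nth gamma s i) (nth gamma s j)]].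
Proof.
move=> V4; have [u [v [a t]]] := tet_exists (ltnW (ltnW V4)).
pose good (s : seq V) := [/\ uniq (gamma :: s),
  exists a, is_tet (nth gamma s 0) (nth gamma s 1) a &
  forall k, (1 < k < size s)%N -> exists i j,
    [/\ (i < k)%N, (j < k)%N & is_tet (nth gamma s k) (nth gamma s i) (nth gamma s j)]].
have H k : (1 < k < #|V|)%N -> exists2 s, size s = k & good s.
  elim: k => [//|k IH] /andP [k1 kV]; case: (ltnP 1 k) => [k2|k2]; last first.
    have -> : k = 1%N by lia.
    exists [:: u; v] => //; split; [|by exists a|by move=> j /=; lia].
    by have [[ug vg _] [uv _ _]] := is_tet_neq t; rewrite /= !inE !negb_or ![gamma == _]eq_sym ug vg uv.
  have [|s sk [us [a0 t0] sh]] := IH; first by rewrite k2 ltnW.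
  have [w] : exists w, w \notin gamma :: s.
    apply: contrapT => none; suff VE : #|V| = size (gamma :: s) by rewrite VE /= sk ltnn in kV.
    rewrite -(card_uniqP us); apply: eq_card => x.
    rewrite [LHS]inE; apply/esym; case: (boolP (x \in gamma :: s)) => // nx.
    by case: none; exists x.
  rewrite inE negb_or => /andP [wg ws].
  have [T Tt wT] := link_cover HL wg.
  have s0 : nth gamma s 0 \in s by rewrite mem_nth // sk; lia.
  have s1 : nth gamma s 1 \in s by rewrite mem_nth // sk.
  have [x [y [z [txyz xs ys zs]]]] : exists x y z, [/\ is_tet x y z, x \in s, y \in s & z \notin s].
    apply: contrapT => none.
    have full x y z : is_tet x y z -> x \in s -> y \in s -> z \in s.
      move=> txyz xs ys; apply: contrapT => /negP zs; apply: none.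
      by exists x, y, z.
    pose P (T : {set V}) := {subset T <= gamma :: s}.
    suff : P T by move=> /(_ w wT); rewrite inE (negbTE wg) (negbTE ws).
    have P3 x y z : is_tet x y z -> x \in s -> y \in s -> P (tet x y z).
      move=> txyz xs ys b; rewrite !inE -!orbA => /or4P [/eqP ->|/eqP ->|/eqP ->|/eqP ->].
      - by rewrite eqxx.
      - by rewrite xs orbT.
      - by rewrite ys orbT.
      - by rewrite (full _ _ _ txyz xs ys) orbT.
    apply: (@all_path_ind P _ t0) => //; first exact: P3.
    move=> x y b c tb tc Pc; have uq := is_tet_neq tc.
    have [xs ys] : x \in s /\ y \in s.
      have [[xg yg _] _] := uq.
      have := Pc x; have := Pc y; rewrite !inE !eqxx !orbT => /(_ isT) + /(_ isT).
      by rewrite (negbTE xg) (negbTE yg).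
    exact: P3.
  have zg : z != gamma.
    by have [[]] := is_tet_neq txyz.
  exists (rcons s z); first by rewrite size_rcons sk.
  have ncat i : (i < k)%N -> nth gamma (rcons s z) i = nth gamma s i.
    by move=> ik; rewrite nth_rcons sk ik.
  split.
  - rewrite /= mem_rcons inE negb_or eq_sym zg rcons_uniq zs /=.
    by move: us => /= /andP [-> ->].
  - by exists a0; rewrite !ncat //; lia.
  - move=> j /andP [j1]; rewrite size_rcons sk ltnS leq_eqVlt => /orP [/eqP ->|jk].
      exists (index x s), (index y s); rewrite -sk !index_mem xs ys; split=> //.
      rewrite !nth_rcons !index_mem xs ys ltnn eqxx !nth_index //.
      by rewrite is_tetCA is_tetAC is_tetCA in txyz; rewrite is_tetAC.
    have [|i [l [ij lj til]]] := sh j; first by rewrite j1 sk.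
    exists i, l; rewrite (ncat j jk) (ncat i (ltn_trans ij jk)) (ncat l (ltn_trans lj jk)).
    by split.
have [|s sk [us t0 sh]] := H #|V|.-1; first by lia.
exists s; split=> //; first by move: us => /= /andP [].
move=> x; have /(_ x) : (gamma :: s) =i predT.
  apply/subset_cardP; last exact/fintype.subsetP.
  by rewrite (card_uniqP us) /= sk; apply: (@prednK #|V|); apply: leq_trans V4.
rewrite !inE => E; move: us => /= /andP [gs _].
by have [-> |] := eqVneq x gamma; [apply/negbTE | move=> /negbTE xg; move: E; rewrite xg].
Qed.

End Link.

(** * Special positions *)

(** Among eps/2, eps/3, ... there are [size D] distinct candidates, more than D has roots. *)
Lemma nonroot_small (R : realFieldType) (D : {poly R}) (eps : R) :
  D != 0 -> 0 < eps -> exists t, [/\ 0 < t, t < eps & D.[t] != 0].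
Proof.
move=> D0 e0; pose s : seq R := [seq eps / i.+2%:R | i <- iota 0 (size D)].
have us : uniq s.
  rewrite map_inj_uniq ?iota_uniq // => i j /(mulfI (lt0r_neq0 e0)) /invr_inj /eqP.
  by rewrite eqr_nat => /eqP [].
have [/(max_poly_roots D0)/(_ us)|] := boolP (all (root D) s).
  by rewrite size_map size_iota ltnn.
case/allPn => _ /mapP [i _ ->] nr; exists (eps / i.+2%:R); split=> //.
- by rewrite divr_gt0.
- by rewrite ltr_pdivrMr // ltr_pMr // ltr1n.
Qed.

Section Vectors.
Variable R : pzRingType.
Definition vec (a b c : R) : 'rV[R]_3 := \row_j [:: a; b; c]`_j.

Lemma vecD a b c a' b' c' : vec a b c + vec a' b' c' = vec (a + a') (b + b') (c + c').
Proof. by apply/rowP => -[[|[|[|//]]] i3]; rewrite !mxE. Qed.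

Lemma vecZ k a b c : k *: vec a b c = vec (k * a) (k * b) (k * c).
Proof. by apply/rowP => -[[|[|[|//]]] i3]; rewrite !mxE. Qed.

Lemma vecE (x : 'rV[R]_3) : x = vec (x ord0 ord0) (x ord0 (inord 1)) (x ord0 (inord 2)).
Proof.
apply/rowP => -[[|[|[|//]]] i3]; rewrite !mxE /=; congr (x _ _); apply: val_inj => //=;
  by rewrite inordK.
Qed.
End Vectors.

Section Orders.
Variable R : realType.
Implicit Types (p q : mpoly 3 R) (u v : 'rV[R]_3).

Lemma ordplane0 n u v : ordplane n (0 : mpoly 3 R) u v.
Proof. by move=> X Y w; rewrite lin0 dvdp0. Qed.

Lemma ordplaneD n p q u v :
  ordplane n p u v -> ordplane n q u v -> ordplane n (p + q) u v.
Proof. by move=> hp hq X Y w; rewrite linD dvdp_add // ?hp ?hq. Qed.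

Lemma ordplaneN n q u v : ordplane n q u v -> ordplane n (- q) u v.
Proof. by move=> hq X Y w; rewrite linN dvdpNr hq. Qed.

Lemma ordplane_sym n q u v : ordplane n q u v -> ordplane n q v u.
Proof. by move=> h X Y; rewrite addrC; apply: h. Qed.

Lemma ordat_gt_eq0 d q u : homogeneous d q -> ordat d.+1 q u -> q = 0.
Proof.
move=> hq ou; apply: meval_fun_eq0 => x.
have [h [sz z E]] := homogeneous_expansion u x 0 hq.
have -> : x = 0 *: u + 1 *: x + 0 *: 0 by rewrite !scale0r add0r scale1r addr0.
rewrite E big1 // => m _.
by rewrite (ordat_expansion0 sz z E ou (ltn_ord m)) binary0 mulr0.
Qed.

(** In this chart a plane through the ray of (1, a, b) is given by its slope c, through the
    direction (0, 1, c). *)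
Lemma ordat_pencil_vec (I : finType) d s (n : I -> nat) (c : I -> R)
    (q : I -> mpoly 3 R) a b :
  injective c -> (forall i, homogeneous d (q i)) -> \sum_i q i = 0 ->
  (forall i X, ordat (n i) (q i) (X *: vec 1 a b + vec 0 1 (c i))) ->
  (forall m, m < s -> \sum_i (m.+1 - n i) <= m.+1)%N ->
  forall i, ordat s (q i) (vec 1 a b).
Proof.
move=> c_inj hq q0 oq; apply: (ordat_pencil (v := vec 0 1 0) (w := vec 0 0 1)) c_inj hq q0 _.
- move=> x; pose x0 := x ord0 ord0.
  exists x0, (x ord0 (inord 1) - x0 * a), (x ord0 (inord 2) - x0 * b).
  by rewrite {1}[x]vecE !vecZ !vecD; congr vec; rewrite /x0; ring.
- move=> i X; have -> : vec 0 1 0 + c i *: vec 0 0 1 = vec 0 1 (c i) by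
    rewrite vecZ vecD; congr vec; ring.
  exact: oq.
Qed.

(* The limit as t -> 0 of the plane through the vertices of ranks k < l of
   exists_rigid, placed at (1, t^(k+1), k t^(k+1)). *)
Definition limit_plane n q (k : nat) := ordplane n q (vec 1 0 0) (vec 0 1 k%:R).

Lemma limit_plane_ordat n q k (X : R) :
  limit_plane n q k -> ordat n q (X *: vec 1 0 0 + vec 0 1 k%:R).
Proof. by move=> h; rewrite -[vec 0 1 _]scale1r; apply: h. Qed.

(** The pencil of p, - q and q - p, which sum to zero: 3 (m + 1 - n) <= m + 1 for all m <= d amounts
    to 2 d + 2 <= 3 n, so p vanishes to order d + 1. *)
Lemma limit_planes3 d n (k1 k2 k3 : nat) p q :
  (2 * d + 2 <= 3 * n)%N -> uniq [:: k1; k2; k3] ->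
  homogeneous d p -> homogeneous d q ->
  limit_plane n p k1 -> limit_plane n q k2 -> limit_plane n (p - q) k3 -> p = 0.
Proof.
move=> dn uk hp hq op oq opq.
pose Q (i : 'I_3) := nth 0 [:: p; - q; q - p] i.
pose c (i : 'I_3) : R := (nth 0%N [:: k1; k2; k3] i)%:R.
have /= P0 := @ordat_pencil_vec 'I_3 d d.+1 (fun=> n) c Q 0 0 _ _ _ _ _ ord0.
apply: ordat_gt_eq0 (hp) (P0 _ _ _ _ _).
- move=> i j /eqP; rewrite eqr_nat nth_uniq // => /eqP; exact: val_inj.
- case=> -[|[|[|//]]] i3; rewrite /Q /= /homogeneous ?rpredN ?rpredB //.
- by rewrite !big_ord_recl big_ord0 /Q /= addr0 addrA subrKA subrr.
- case=> -[|[|[|//]]] i3 X; rewrite /Q /c /=; apply: limit_plane_ordat => //.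
    exact: ordplaneN.
  by rewrite -opprB; apply: ordplaneN.
- by move=> m ms; rewrite sum_nat_const card_ord; lia.
Qed.

Lemma limit_planes2 d n (k1 k2 : nat) p :
  (2 * d + 2 <= 3 * n)%N -> k1 != k2 -> homogeneous d p ->
  limit_plane n p k1 -> limit_plane n p k2 -> p = 0.
Proof.
move=> dn k12 hp o1 o2.
pose Q (i : 'I_2) := nth 0 [:: p; - p] i.
pose c (i : 'I_2) : R := (nth 0%N [:: k1; k2] i)%:R.
have /= P0 := @ordat_pencil_vec 'I_2 d d.+1 (fun=> n) c Q 0 0 _ _ _ _ _ ord0.
apply: ordat_gt_eq0 (hp) (P0 _ _ _ _ _).
- move=> i j /eqP; rewrite eqr_nat nth_uniq //= ?inE ?k12 // => /eqP; exact: val_inj.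
- case=> -[|[|//]] i3; rewrite /Q /= /homogeneous ?rpredN //.
- by rewrite !big_ord_recl big_ord0 /Q /= addr0 subrr.
- case=> -[|[|//]] i3 X; rewrite /Q /c /=; apply: limit_plane_ordat => //.
  exact: ordplaneN.
- by move=> m ms; rewrite sum_nat_const card_ord; lia.
Qed.
End Orders.

(** * Rigidity in the limit position *)

Section Hierarchical.
Variables (R : realType) (V : finType) (Delta : {set {set V}}) (gamma : V).
Local Notation tet := (tet gamma).
Local Notation is_tet := (is_tet Delta gamma).
Local Notation nbr := (nbr Delta gamma).
Hypothesis HL : closed_link Delta gamma.
Variable s : seq V.
Hypotheses (us : uniq s) (sE : s =i predC1 gamma)
  (s01 : exists a, is_tet (nth gamma s 0) (nth gamma s 1) a)
  (sh : forall k, (1 < k < size s)%N -> exists i j,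
     [/\ (i < k)%N, (j < k)%N & is_tet (nth gamma s k) (nth gamma s i) (nth gamma s j)]).
Local Notation rk v := (index v s).

Lemma rk_inj u v : u != gamma -> rk u = rk v -> u = v.
Proof.
move=> ug e; have uS : u \in s by rewrite sE.
have vS : v \in s by rewrite -index_mem -e index_mem.
by rewrite -(nth_index gamma uS) e nth_index.
Qed.

Variables (n d : nat) (q : {set V} -> mpoly 3 R).
Hypotheses (dn : (2 * d + 2 <= 3 * n)%N) (hq : forall T, homogeneous d (q T)).
Hypothesis sm : forall u v a b, is_tet u v a -> is_tet u v b ->
  limit_plane n (q (tet u v a) - q (tet u v b)) (minn (rk u) (rk v)).

Lemma limit_planeB_trans k (p p' p'' : mpoly 3 R) :
  limit_plane n (p - p') k -> limit_plane n (p' - p'') k -> limit_plane n (p - p'') k.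
Proof. by move=> h h'; rewrite -(subrKA p'); apply: ordplaneD. Qed.

(** Walking around [a], each crossed edge {a, v} either has [v] of rank below k, where the value [Q]
    is known, or has slope [rk a]. So the difference from [Q] always vanishes on that slope. *)
Lemma walk_low a k Q : (rk a < k)%N ->
  (exists z b, is_tet a z b /\ (rk z < k)%N) ->
  (forall z b, is_tet a z b -> (rk z < k)%N -> q (tet a z b) = Q) ->
  forall c b, is_tet a c b -> limit_plane n (q (tet a c b) - Q) (rk a).
Proof.
move=> ak [z [b [t zk]]] low c e t'.
have mem v w : a \in tet a v w by rewrite !inE eqxx !orbT.
have [[ag _ _] _] := is_tet_neq t.
pose P T := limit_plane n (q T - Q) (rk a).
apply: (@star_path_ind _ _ _ HL a P (tet a z b) ag t (mem _ _)) (t') (mem _ _).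
  by rewrite /P low // subrr; apply: ordplane0.
move=> v x y tx ty Py; case: (ltnP (rk v) k) => vk.
  by rewrite /P low // subrr; apply: ordplane0.
apply: limit_planeB_trans Py; have := sm tx ty.
by rewrite (minn_idPl _) //; apply: ltnW; apply: leq_trans vk.
Qed.

(** Walk around [v] from [c], avoiding [a], up to the first vertex [a'] of lower rank. All edges {v,
    y} crossed before have y above v, hence slope [rk v]. *)
Lemma walk_high v a c : is_tet v a c -> (rk a < rk v)%N -> (rk v < rk c)%N ->
  (exists a2, [/\ nbr v a2, a2 != a & (rk a2 < rk v)%N]) ->
  exists a' y, [/\ is_tet v y a', a' != a, (rk a' < rk v)%N, (rk v < rk y)%N &
    limit_plane n (q (tet v c a) - q (tet v y a')) (rk v)].
Proof.
move=> t av vc [a2 [va2 a2a a2v]].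
have /connectP [p] := link_minus_connected HL t va2 a2a.
move: t; rewrite is_tetAC.
suff H x : is_tet v c x -> path [rel z w | [&& is_tet v z w, z != a & w != a]] c p ->
    a2 = last c p -> exists a' y, [/\ is_tet v y a', a' != a, (rk a' < rk v)%N,
      (rk v < rk y)%N & limit_plane n (q (tet v c x) - q (tet v y a')) (rk v)] by apply: H.
elim: p c x vc => [|y p IH] c x vc t /=.
  by move=> _ e; rewrite e in a2v; move: (ltn_trans a2v vc); rewrite ltnn.
case/andP => /and3P [tcy ca ya] pth lst.
have step : limit_plane n (q (tet v c x) - q (tet v c y)) (rk v).
  by have := sm t tcy; rewrite (minn_idPl (ltnW vc)).
case: (ltngtP (rk y) (rk v)) => yv.
- by exists y, c; split.
- have tyc : is_tet v y c by rewrite is_tetAC.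
  have [a' [z [tz a'a a'v vz o]]] := IH y c yv tyc pth lst.
  exists a', z; split=> //; apply: limit_planeB_trans step _.
  by rewrite tetAC.
- have [_ [_ vy _]] := is_tet_neq tcy; have [[vg _ _] _] := is_tet_neq tcy.
  by rewrite (rk_inj vg (esym yv)) eqxx in vy.
Qed.

(** Induction on k: the tetrahedra having an edge of the link with both ranks at most k all carry
    the value [Q]. *)
Lemma hierarchical_const S T :
  S \in tetrahedra Delta -> T \in tetrahedra Delta -> q S = q T.
Proof.
have [a0 t0] := s01; set v0 := nth gamma s 0 in t0; set v1 := nth gamma s 1 in t0.
have [[v0g v1g a0g] [v01 v0a0 v1a0]] := is_tet_neq t0.
have szs : (1 < size s)%N.
  by rewrite ltnNge; apply: contraNN v1g => h; rewrite /v1 nth_default.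
have rk0 : rk v0 = 0%N by rewrite index_uniq // (ltnW szs).
have rk1 : rk v1 = 1%N by rewrite index_uniq.
pose Q := q (tet v0 v1 a0).
pose low k := forall u v a, is_tet u v a -> (rk u <= k)%N -> (rk v <= k)%N ->
  q (tet u v a) = Q.
have rk_v0 v : v != gamma -> (rk v = 0)%N -> v = v0.
  by move=> vg e; apply: rk_inj => //; rewrite e.
have rk_v1 v : v != gamma -> (rk v = 1)%N -> v = v1.
  by move=> vg e; apply: rk_inj => //; rewrite e.
(* Only the edge {v0, v1} matters. The difference of its two tetrahedra vanishes on slope 0, across
   this edge, and on slope 1, by walking around [v1] away from [v0]. *)
have base : low 1%N.
  suff H a : is_tet v0 v1 a -> q (tet v0 v1 a) = Q.
    move=> u v a t; have [[ug vg _] [uv _ _]] := is_tet_neq t.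
    case eu : (rk u) => [|[|//]] _; case ev : (rk v) => [|[|//]] _.
    - by rewrite (rk_v0 u) // (rk_v0 v) // eqxx in uv.
    - by move: t; rewrite (rk_v0 u) // (rk_v1 v) //; apply: H.
    - by move: t; rewrite (rk_v1 u) // (rk_v0 v) // is_tetCA tetCA; apply: H.
    - by rewrite (rk_v1 u) // (rk_v1 v) // eqxx in uv.
  move=> t; apply/eqP; rewrite -subr_eq0; apply/eqP.
  have hd : homogeneous d (q (tet v0 v1 a) - Q) by apply: rpredB; apply: hq.
  apply: (limit_planes2 dn (_ : 0 != 1)%N hd) => //.
    by have := sm t t0; rewrite rk0 min0n.
  have [_ [_ v0a v1a]] := is_tet_neq t.
  have t1 : is_tet v1 v0 a by rewrite is_tetCA.
  have a0v0 : a0 != v0 by rewrite eq_sym.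
  have nb : nbr v1 a0 by apply/nbrP; exists v0; rewrite is_tetAC is_tetCA.
  have /connectP [p] := link_minus_connected HL t1 nb a0v0.
  rewrite /Q ![tet v0 v1 _]tetCA ![tet v1 v0 _]tetAC.
  have {t1} : is_tet v1 a v0 by rewrite is_tetAC.
  have {v0a} : a != v0 by rewrite eq_sym.
  (* Only [v0] has rank 0, so every crossing of this walk has slope 1. *)
  have min1 c : is_tet v1 c v0 \/ c != gamma -> c != v0 -> minn 1 (rk c) = 1%N.
    move=> h cv0; apply/minn_idPl; rewrite lt0n; apply: contraNN cv0 => /eqP e.
    apply/eqP/rk_v0 => //; case: h => // /is_tet_neq [[_ ->]].
    by [].
  suff H x : a != v0 -> is_tet v1 a x ->
      path [rel z w | [&& is_tet v1 z w, z != v0 & w != v0]] a p -> a0 = last a p ->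
      limit_plane n (q (tet v1 a x) - q (tet v1 a0 v0)) 1 by apply: H.
  elim: p a {t hd v1a} x => [|y p IH] c x cv0 t /=.
    move=> _ e; rewrite e; have := sm t.
    have t0' : is_tet v1 c v0 by rewrite -e is_tetAC is_tetCA.
    move=> /(_ _ t0'); rewrite rk1 min1 //; last by left.
  case/andP => /and3P [tcy _ yv0] pth lst.
  have tyc : is_tet v1 y c by rewrite is_tetAC.
  apply: limit_planeB_trans (IH y c yv0 tyc pth lst).
  have := sm t tcy; rewrite rk1 min1 //.
    by rewrite [tet v1 y c]tetAC.
  by right; case: (is_tet_neq tcy) => -[].
have step k : (0 < k)%N -> (k.+1 < size s)%N -> low k -> low k.+1.
  move=> k0 ks lk.
  set v := nth gamma s k.+1.
  have rkv : rk v = k.+1 by rewrite index_uniq.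
  have vg : v != gamma by have := mem_nth gamma ks; rewrite sE.
  have lower a : a != gamma -> (rk a <= k)%N -> exists z b, is_tet a z b /\ (rk z < k.+1)%N.
    move=> ag ak; case ea : (rk a) => [|[|l]].
    - by exists v1, a0; rewrite (rk_v0 a) // rk1 ltnS.
    - by exists v0, a0; rewrite (rk_v1 a) // rk0 is_tetCA.
    - have [|i [j [il jl t]]] := sh (k := l.+2); first by rewrite /= -ea index_mem sE.
      exists (nth gamma s i), (nth gamma s j); rewrite index_uniq //; last first.
        by apply: ltn_trans il _; rewrite -ea index_mem sE.
      split; last by rewrite ltnS (leq_trans (ltnW il)) // -ea.
      by move: t; rewrite -ea nth_index // sE.
  have at_a a : a != gamma -> (rk a <= k)%N -> forall c b, is_tet a c b ->
      limit_plane n (q (tet a c b) - Q) (rk a).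
    move=> ag ak; apply: walk_low (lower a ag ak) _ => [|z b tz zk]; first by rewrite ltnS.
    by apply: lk => //; rewrite -ltnS.
  (* If [c] precedes [v], the edge {a, c} is covered by [low k]. Otherwise [v] has a second earlier
     neighbour, by the choice of the order, and [walk_high] applies. *)
  have new a c : is_tet v a c -> (rk a <= k)%N -> q (tet v a c) = Q.
    move=> t ak; have [[_ ag cg] [va vc ac]] := is_tet_neq t.
    case: (ltngtP (rk c) (rk v)) => cv.
    - rewrite [tet v a c]tetCA tetAC; apply: lk => //; last by rewrite -ltnS -rkv.
      by rewrite is_tetAC is_tetCA.
    - have [|i [j [ik jk tij]]] := sh (k := k.+1); first by rewrite ks ltnS k0.
      rewrite -/v in tij; have [_ [_ _ ij]] := is_tet_neq tij.
      have av : (rk a < rk v)%N by rewrite rkv ltnS.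
      have [|a' [y [ty a'a a'v yv o]]] := walk_high t av cv.
        have si m : (m < k.+1)%N -> (rk (nth gamma s m) < rk v)%N.
          by move=> mk; rewrite rkv index_uniq //; apply: ltn_trans ks.
        have [ia|ia] := eqVneq (nth gamma s i) a.
          exists (nth gamma s j); split; last exact: si.
            by apply/nbrP; exists (nth gamma s i); rewrite is_tetAC.
          by rewrite -ia eq_sym.
        exists (nth gamma s i); split=> //; last exact: si.
        by apply/nbrP; exists (nth gamma s j).
      have a'k : (rk a' <= k)%N by rewrite -ltnS -rkv.
      have [[_ _ a'g] _] := is_tet_neq ty.
      apply/eqP; rewrite -subr_eq0; apply/eqP.
      have hB U W : homogeneous d (q U - q W) by apply: rpredB; apply: hq.
      (* Slopes: [rk a] for the difference at [tet v a c], [rk a'] for the one at [tet v y a'], and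
         [rk v] between the two. *)
      apply: (@limit_planes3 R d n (rk a) (rk a') (rk v) _ (q (tet v y a') - Q) dn _ (hB _ _) (hB _ _)).
      + rewrite /= !inE negb_or andbT -andbA; apply/and3P; split.
        * by apply: contraNneq a'a => e; rewrite (rk_inj a'g (esym e)).
        * by rewrite neq_ltn av.
        * by rewrite neq_ltn a'v.
      + by rewrite [tet v a c]tetCA; apply: at_a => //; rewrite is_tetCA.
      + rewrite tetAC [tet v a' y]tetCA; apply: at_a => //.
        by rewrite is_tetCA is_tetAC.
      + by rewrite opprB addrA subrK [tet v a c]tetAC.
    - by rewrite (rk_inj cg cv) eqxx in vc.
  have rk_v u : u != gamma -> rk u = k.+1 -> u = v by move=> ug e; apply: rk_inj => //; rewrite rkv.
  move=> u w a t; have [[ug wg _] [uw _ _]] := is_tet_neq t.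
  rewrite leq_eqVlt => /orP [/eqP/(rk_v _ ug) uv|]; last rewrite ltnS => uk.
    rewrite leq_eqVlt => /orP [/eqP/(rk_v _ wg) wv|]; last rewrite ltnS => wk.
      by rewrite uv wv eqxx in uw.
    by move: t; rewrite uv => t; apply: new.
  rewrite leq_eqVlt => /orP [/eqP/(rk_v _ wg) wv|]; last rewrite ltnS => wk.
    by move: t; rewrite wv is_tetCA tetCA => t; apply: new.
  exact: lk.
have all k : (0 < k)%N -> (k < size s)%N -> low k.
  elim: k => [//|k IH] _ ks; case: (posnP k) => [-> //|k0].
  by apply: step => //; apply: IH => //; apply: ltnW.
suff H U : U \in tetrahedra Delta -> q U = Q by move=> /H -> /H ->.
have last : low (size s).-1 by apply: all; lia.
have [x [y [z _]]] : exists u v a, is_tet u v a by exists v0, v1, a0.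
apply: (@all_path_ind _ _ _ HL (fun U => q U = Q) (tet v0 v1 a0)) => // u v a b ta tb _.
have [[ug vg _] _] := is_tet_neq ta.
by apply: last => //; rewrite -ltnS prednK ?index_mem ?sE // ltnW.
Qed.
End Hierarchical.

(** * Arithmetic of the orders, and permutations of three vertices *)

Lemma half3_le m : (2 * (3 * m)./2 <= 3 * m)%N.
Proof. lia. Qed.

(** For odd m the two floors lose one in total, which the hypothesis just absorbs. *)
Lemma half3_sum m d : (d + 2 <= 2 * m)%N -> (m.+1 <= (3 * m)./2 + (3 * m)./2 - d)%N.
Proof. lia. Qed.

Lemma bipyramid_apex_sum n d : (3 * d + 3 <= 5 * n)%N ->
  (n.+1 <= (3 * n)./2 + (4 * n) %/ 3 - d)%N.
Proof. lia. Qed.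

(** (4 n + 2) / 3 is the order on the equator once the triangles at the apexes have reached order n
    + 1. *)
Lemma bipyramid_equator_sum n d : (3 * d + 3 <= 5 * n)%N ->
  (n.+1 <= (4 * n + 2) %/ 3 + (4 * n + 2) %/ 3 - d)%N.
Proof. lia. Qed.

Lemma perm_bipyramid (T : eqType) (t a u b v : T) :
  perm_eq [:: t; a; u; b; v] [:: a; b; u; v; t].
Proof. by apply/permP => P /=; lia. Qed.

Lemma bipyramid_equator_bounds n :
  (3 * (4 * n %/ 3) <= 2 * n + 2 * n)%N /\ (4 * n %/ 3 <= 2 * n)%N.
Proof. lia. Qed.

Lemma bipyramid_equator_bounds' n : (0 < n)%N ->
  [/\ 3 * ((4 * n + 2) %/ 3) <= 2 * n.+1 + 2 * n, (4 * n + 2) %/ 3 <= 2 * n.+1 &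
      (4 * n + 2) %/ 3 <= 2 * n]%N.
Proof. by split; lia. Qed.

Lemma perm2_cases (T : eqType) (v t z w : T) :
  perm_eq [:: v; t] [:: z; w] -> (v = z /\ t = w) \/ (v = w /\ t = z).
Proof.
have one (x y : T) : perm_eq [:: x] [:: y] -> x = y.
  by move/perm_mem/(_ x); rewrite !inE eqxx => /esym/eqP.
move=> p; have : v \in [:: z; w] by rewrite -(perm_mem p) mem_head.
rewrite !inE => /orP [] /eqP e; move: p; rewrite e.
  by rewrite perm_cons => /one ->; left.
by rewrite perm_sym (perm_catC [:: z] [:: w]) perm_cons => /one ->; right.
Qed.

(** Adjacent transpositions generate all permutations. *)
Lemma perm3_ind (T : eqType) (P : T -> T -> T -> Prop) y z w :
  (forall u v t, P u v t -> P v u t) -> (forall u v t, P u v t -> P u t v) -> P y z w ->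
  forall u v t, perm_eq [:: u; v; t] [:: y; z; w] -> P u v t.
Proof.
move=> P12 P23 P0 u v t p.
have : u \in [:: y; z; w] by rewrite -(perm_mem p) mem_head.
rewrite !inE => /or3P [] /eqP e; move: p; rewrite e.
- by rewrite perm_cons => /perm2_cases [] [-> ->] //; apply: P23.
- rewrite perm_sym (perm_catCA [:: y] [:: z]) perm_cons perm_sym.
  by case/perm2_cases => -[-> ->]; [apply/P12 | apply/P23/P12].
- rewrite perm_sym (perm_catC [:: y; z] [:: w]) perm_cons perm_sym.
  by case/perm2_cases => -[-> ->]; [apply/P12/P23 | apply/P23/P12/P23].
Qed.

(** * Rigid positions for each type of link *)

Section RigidExamples.
Variables (R : realType) (V : finType) (Delta : {set {set V}}) (gamma : V).
Local Notation E := 'rV[R]_3.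
Local Notation tet := (tet gamma).
Local Notation is_tet := (is_tet Delta gamma).
Local Notation nbr := (nbr Delta gamma).
Hypothesis HL : closed_link Delta gamma.

Definition rigid_at n d (p : V -> E) :=
  rigid Delta gamma n d (fun u _ => p u) (fun _ v => p v).

(** Contact on a larger span implies contact on a smaller one, so rigidity passes from the smaller
    spans to the larger. *)
Lemma rigid_span n d (A B A' B' : V -> V -> E) :
  (forall u v a, is_tet u v a -> forall X Y, exists X' Y',
     X *: A' u v + Y *: B' u v = X' *: A u v + Y' *: B u v) ->
  rigid Delta gamma n d A' B' -> rigid Delta gamma n d A B.
Proof.
move=> sp rig q hq sm; apply: rig => // u v a b ta tb X Y.
by have [X' [Y' ->]] := sp u v a ta X Y; apply: sm.
Qed.

(** The vertex of rank k goes to (1, t^(k+1), k t^(k+1)). At t = 0 the suitably rescaled planes are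
    those of [hierarchical_const], and [rigid_generic] moves to some t > 0. *)
Lemma exists_rigid n d : (3 < #|V|)%N -> (2 * d + 2 <= 3 * n)%N ->
  exists2 p : V -> E, p gamma = 0 & rigid_at n d p.
Proof.
move=> V4 dn; have [s [us sE s01 sh]] := shelling_order HL V4.
pose a u v := minn (index u s) (index v s).
pose b u v := maxn (index u s) (index v s).
pose A u v : 'rV[{poly R}]_3 := vec 1 'X^((a u v).+1) ((a u v)%:R * 'X^((a u v).+1)).
(* The earlier vertex minus the later one, divided by t^(a+1); at t = 0 this is (0, 1, a), since a <
   b. *)
pose B u v : 'rV[{poly R}]_3 :=
  vec 0 (1 - 'X^(b u v - a u v)) ((a u v)%:R - (b u v)%:R * 'X^(b u v - a u v)).
have evA t u v : eval_at t A u v = vec 1 (t ^+ (a u v).+1) ((a u v)%:R * t ^+ (a u v).+1).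
  apply/rowP => -[[|[|[|//]]] i3]; rewrite !mxE /= /horner_eval.
  - by rewrite hornerE.
  - by rewrite hornerXn.
  - by rewrite hornerM hornerXn -polyC_natr hornerC.
have evB t u v : eval_at t B u v =
    vec 0 (1 - t ^+ (b u v - a u v)) ((a u v)%:R - (b u v)%:R * t ^+ (b u v - a u v)).
  apply/rowP => -[[|[|[|//]]] i3]; rewrite !mxE /= /horner_eval.
  - by rewrite hornerE.
  - by rewrite hornerD hornerN hornerXn hornerE.
  - by rewrite hornerD hornerN hornerM hornerXn -!polyC_natr !hornerC.
have ab u v c : is_tet u v c -> (a u v < b u v)%N.
  move=> t; have [[ug _ _] [uv _ _]] := is_tet_neq t.
  have : index u s != index v s by apply: contraNneq uv => /(rk_inj sE ug) ->.
  rewrite neq_ltn => /orP [] uv'.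
    by rewrite /a /b (minn_idPl (ltnW uv')) (maxn_idPr (ltnW uv')).
  by rewrite /a /b (minn_idPr (ltnW uv')) (maxn_idPl (ltnW uv')).
have rig0 : rigid Delta gamma n d (eval_at 0 A) (eval_at 0 B).
  apply: (@rigid_span _ _ _ _ (fun _ _ => vec 1 0 0) (fun u v => vec 0 1 (a u v)%:R)).
    move=> u v c t X Y; exists X, Y; rewrite evA evB.
    have := ab _ _ _ t; case: (b u v - a u v)%N (subn_gt0 (a u v) (b u v)) => [<- //|k _ _].
    by rewrite !expr0n /= !mulr0 !subr0.
  move=> q hq sm S T; apply: (hierarchical_const HL us sE s01 sh dn hq) => u v c e tc te.
  exact: sm.
have [D D0 HD] := rigid_generic rig0.
have [t [t0 _ Dt]] := nonroot_small D0 ltr01.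
pose r u := index u s.
pose p u : E := if u == gamma then 0 else vec 1 (t ^+ (r u).+1) ((r u)%:R * t ^+ (r u).+1).
exists p; first by rewrite /p eqxx.
apply: rigid_span (HD t Dt) => u v c tc X Y.
have [[ug vg _] [uv _ _]] := is_tet_neq tc.
have pE w : w != gamma -> p w = vec 1 (t ^+ (r w).+1) ((r w)%:R * t ^+ (r w).+1).
  by rewrite /p => /negbTE ->.
rewrite evA evB (pE u) // (pE v) // {ug vg}.
pose P k : E := vec 1 (t ^+ k.+1) (k%:R * t ^+ k.+1).
(* For nonzero t the rescaled vectors lie in the span of the two vertices. *)
have key i j : (i < j)%N ->
    X *: P i + Y *: vec 0 (1 - t ^+ (j - i)) (i%:R - j%:R * t ^+ (j - i)) =
    (X + Y / t ^+ i.+1) *: P i - (Y / t ^+ i.+1) *: P j.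
  move=> ij; rewrite -[- (_ *: P j)]scaleNr /P !vecZ !vecD.
  have tj : t ^+ j.+1 = t ^+ i.+1 * t ^+ (j - i) by rewrite -exprD addSn subnKC // ltnW.
  have tn : t ^+ i.+1 != 0 by rewrite expf_neq0 // gt_eqF.
  by congr vec; rewrite ?tj; field.
have := ab _ _ _ tc; rewrite -/(P (r u)) -/(P (r v)) /a /b -/(r u) -/(r v).
case: (leqP (r u) (r v)) => [ruv uv'|ruv _]; rewrite key //.
  by exists (X + Y / t ^+ (r u).+1), (- (Y / t ^+ (r u).+1)); rewrite scaleNr.
by exists (- (Y / t ^+ (r v).+1)), (X + Y / t ^+ (r v).+1); rewrite scaleNr addrC.
Qed.

(** The moment curve: at the ray of [moment k], the plane through [moment j] has slope j + k, so
    distinct neighbours give distinct planes. *)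
Definition moment (k : R) : E := vec 1 k (k ^+ 2).

Lemma ordplane_moment n q k j X : j != k ->
  ordplane n q (moment k) (moment j) ->
  ordat n q (X *: moment k + vec 0 1 (j + k)).
Proof.
move=> jk h; pose Y := (j - k)^-1.
have jk0 : j - k != 0 by rewrite subr_eq0.
have -> : X *: moment k + vec 0 1 (j + k) = (X - Y) *: moment k + Y *: moment j.
  by rewrite !vecZ !vecD /Y; congr vec; field.
exact: h.
Qed.

Variable x : V -> R.
Hypothesis x_inj : injective x.
Local Notation opl n g u v := (ordplane n g (moment (x u)) (moment (x v))).

Lemma moment_vertex (I : finType) d s (n : I -> nat) (q : I -> mpoly 3 R) u (v : I -> V) :
  injective v -> (forall i, v i != u) ->
  (forall i, homogeneous d (q i)) -> \sum_i q i = 0 ->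
  (forall i, opl (n i) (q i) u (v i)) ->
  (forall m, m < s -> \sum_i (m.+1 - n i) <= m.+1)%N ->
  forall i, ordat s (q i) (moment (x u)).
Proof.
move=> v_inj vu hq q0 oq; apply: (ordat_pencil_vec (c := fun i => x (v i) + x u)) => //.
- by move=> i j /addIr /x_inj /v_inj.
- by move=> i X; apply: ordplane_moment => //; rewrite (inj_eq x_inj).
Qed.

(** A ray with three tetrahedra: 3 (m + 1 - n) <= m + 1 for all m < s amounts to 2 s <= 3 n. *)
Lemma moment_vertex3 d n s u a b c (f g h : mpoly 3 R) :
  uniq [:: u; a; b; c] -> homogeneous d f -> homogeneous d g -> homogeneous d h ->
  opl n (f - g) u a -> opl n (g - h) u b -> opl n (h - f) u c ->
  (2 * s <= 3 * n)%N ->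
  [/\ ordat s (f - g) (moment (x u)), ordat s (g - h) (moment (x u)) &
      ordat s (h - f) (moment (x u))].
Proof.
move=> uq hf hg hh ofg ogh ohf sn.
pose Q (i : 'I_3) := nth 0 [:: f - g; g - h; h - f] i.
pose v (i : 'I_3) := nth u [:: a; b; c] i.
have hB (p q : mpoly 3 R) : homogeneous d p -> homogeneous d q -> homogeneous d (p - q).
  by move=> hp hq; apply: rpredB.
have [/andP [uabc u3]] : (u \notin [:: a; b; c]) && uniq [:: a; b; c] by [].
have O : forall i, ordat s (Q i) (moment (x u)).
  apply: (moment_vertex (d := d) (n := fun=> n) (v := v)).
  - by move=> i j /eqP; rewrite nth_uniq // => /eqP; apply: val_inj.
  - move=> i; apply: contraNneq uabc => <-; exact: mem_nth.
  - by case=> -[|[|[|//]]] i3; apply: hB.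
  - by rewrite !big_ord_recl big_ord0 /Q /= addr0 !subrKA subrr.
  - by case=> -[|[|[|k]]] i3; [exact: ofg | exact: ogh | exact: ohf | case: (notF i3)].
  - by move=> m ms; rewrite sum_nat_const card_ord; lia.
split; [exact: (O ord0) | exact: (O (Ordinal (isT : (1 < 3)%N))) |].
exact: (O (Ordinal (isT : (2 < 3)%N))).
Qed.

(** A ray with four tetrahedra and alternating orders. The two last bounds cover the case in which
    one of the truncated differences m + 1 - n1, m + 1 - n2 is zero. *)
Lemma moment_vertex4 d n1 n2 s u a b c e (f g h k : mpoly 3 R) :
  uniq [:: u; a; b; c; e] ->
  homogeneous d f -> homogeneous d g -> homogeneous d h -> homogeneous d k ->
  opl n1 (f - g) u a -> opl n2 (g - h) u b -> opl n1 (h - k) u c -> opl n2 (k - f) u e ->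
  (3 * s <= 2 * n1 + 2 * n2)%N -> (s <= 2 * n1)%N -> (s <= 2 * n2)%N ->
  ordat s (f - g) (moment (x u)) /\ ordat s (g - h) (moment (x u)).
Proof.
move=> uq hf hg hh hk ofg ogh ohk okf sn s1 s2.
pose Q (i : 'I_4) := nth 0 [:: f - g; g - h; h - k; k - f] i.
pose v (i : 'I_4) := nth u [:: a; b; c; e] i.
pose n (i : 'I_4) := nth 0%N [:: n1; n2; n1; n2] i.
have hB (p q : mpoly 3 R) : homogeneous d p -> homogeneous d q -> homogeneous d (p - q).
  by move=> hp hq; apply: rpredB.
have /andP [uabc u4] : (u \notin [:: a; b; c; e]) && uniq [:: a; b; c; e] by [].
have O : forall i, ordat s (Q i) (moment (x u)).
  apply: (moment_vertex (d := d) (n := n) (v := v)).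
  - by move=> i j /eqP; rewrite nth_uniq // => /eqP; apply: val_inj.
  - move=> i; apply: contraNneq uabc => <-; exact: mem_nth.
  - by case=> -[|[|[|[|//]]]] i3; apply: hB.
  - by rewrite !big_ord_recl big_ord0 /Q /= addr0 !subrKA subrr.
  - by case=> -[|[|[|[|j]]]] i3;
      [exact: ofg | exact: ogh | exact: ohk | exact: okf | case: (notF i3)].
  - by move=> m ms; rewrite !big_ord_recl big_ord0 /n /=; lia.
by split; [exact: (O ord0) | exact: (O (Ordinal (isT : (1 < 4)%N)))].
Qed.

Variables (d : nat) (q : {set V} -> mpoly 3 R).
Hypothesis hq : forall T, homogeneous d (q T).
Let hB S T : homogeneous d (q S - q T).
Proof. by apply: rpredB; apply: hq. Qed.
Local Notation smoothx n :=
  (smooth Delta gamma n (fun u _ => moment (x u)) (fun _ v => moment (x v)) q).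

Lemma ordplane_le n n' (g : mpoly 3 R) u v :
  (n <= n')%N -> ordplane n' g u v -> ordplane n g u v.
Proof. by move=> nn' h X Y w; apply: dvdp_trans (h X Y w); rewrite dvdp_exp2l. Qed.

Lemma smooth_const : smoothx d.+1 ->
  forall S T, S \in tetrahedra Delta -> T \in tetrahedra Delta -> q S = q T.
Proof.
move=> sm S T St Tt; apply: (@all_path_ind _ _ _ HL (fun U => q U = q T) T) => // u v a b ta tb <-.
apply/eqP; rewrite -subr_eq0; apply/eqP; apply: ordat_gt_eq0 (hB _ _) _.
exact: (sm _ _ _ _ ta tb 0 0).
Qed.

(** Raising the order step by step takes it beyond d, where all differences vanish. *)
Lemma smooth_step_const n0 :
  (forall n, (n0 <= n)%N -> smoothx n -> smoothx n.+1) -> smoothx n0 ->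
  forall S T, S \in tetrahedra Delta -> T \in tetrahedra Delta -> q S = q T.
Proof.
move=> step s0; have H k : smoothx (n0 + k).
  by elim: k => [|k IH]; rewrite ?addn0 // addnS; apply: step => //; apply: leq_addr.
apply: smooth_const => u v a b ta tb; apply: ordplane_le (H d.+1 u v a b ta tb).
exact: leq_addl.
Qed.

Lemma cover_list (l : seq V) : uniq l -> size l = #|V| -> forall v, v \in l.
Proof.
move=> ul sl v; have /(_ v) -> // : l =i predT.
by apply/subset_cardP; [rewrite (card_uniqP ul) sl | apply/fintype.subsetP].
Qed.

(** The link has four vertices. The second triangles on two edges at [u] use the only vertex left,
    so every pair of other vertices forms a triangle with [u]. *)
Lemma tetrahedron_link : #|V| = 5 ->
  forall u v a, uniq [:: gamma; u; v; a] -> is_tet u v a.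
Proof.
move=> V5 u v a; rewrite /= !inE !negb_or andbT.
case/and3P => /and3P [gu gv ga] /andP [uv ua] va.
have [y [z t]] : exists y z, is_tet u y z by apply: nbr_exists HL _ _; rewrite eq_sym.
have [z' [z'z t' _]] := link_two HL t.
have [[ug yg zg] [uy uz yz]] := is_tet_neq t.
have [[_ _ z'g] [_ uz' yz']] := is_tet_neq t'.
have ul : uniq [:: gamma; u; y; z; z'].
  by rewrite /= !inE !negb_or ![gamma == _]eq_sym ug yg zg z'g uy uz uz' yz yz' eq_sym z'z.
have cov := cover_list ul (esym V5).
have t'' : is_tet u z z'.
  have tz : is_tet u z y by rewrite is_tetAC.
  have [w [wy tw _]] := link_two HL tz; have [[_ _ wg] [_ uw zw]] := is_tet_neq tw.
  have := cov w; rewrite !inE (negbTE wg) (negbTE wy) (eq_sym w u) (negbTE uw).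
  by rewrite (eq_sym w z) (negbTE zw) /= => /eqP <-.
have := cov v; have := cov a; rewrite !inE (eq_sym a gamma) (eq_sym v gamma).
rewrite (negbTE gv) (negbTE ga) (eq_sym v u) (eq_sym a u) (negbTE uv) (negbTE ua) /=.
move=> /or3P [] /eqP ea /or3P [] /eqP ev; rewrite ea ev ?eqxx // in va *; by rewrite is_tetAC.
Qed.

(* Supersmoothness bootstrap: order n across the planes forces order 3n/2 at the
   rays, hence order 3n/2 + 3n/2 - d > n across the planes. *)
Lemma tetrahedron_const n : #|V| = 5 -> (d + 2 <= 2 * n)%N -> smoothx n ->
  forall S T, S \in tetrahedra Delta -> T \in tetrahedra Delta -> q S = q T.
Proof.
move=> V5 dn; apply: smooth_step_const => m nm sm u v a b ta tb.
have [<-|ab] := eqVneq a b; first by rewrite subrr; apply: ordplane0.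
have all := tetrahedron_link V5.
have vertex u' v' : is_tet u' v' a -> is_tet u' v' b ->
    ordat (3 * m)./2 (q (tet u' v' a) - q (tet u' v' b)) (moment (x u')).
  move=> ta' tb'; have [[ug vg ag] [uv ua va]] := is_tet_neq ta'.
  have [[_ _ bg] [_ ub vb]] := is_tet_neq tb'.
  (* The third tetrahedron, closing the cycle around the ray of u'. *)
  have tc : is_tet u' a b.
    by apply: all; rewrite /= !inE !negb_or ![gamma == _]eq_sym ug ag bg ua ub ab.
  have [] := @moment_vertex3 d m (3 * m)./2 u' v' b a (q (tet u' v' a)) (q (tet u' v' b)) (q (tet u' a b)).
  - by rewrite /= !inE !negb_or uv ub ua vb va eq_sym ab.
  - exact: hq.
  - exact: hq.
  - exact: hq.
  - exact: sm.
  - by rewrite [tet u' v' b]tetAC [tet u' a b]tetAC; apply: sm; rewrite is_tetAC.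
  - by rewrite [tet u' v' a]tetAC; apply: sm => //; rewrite is_tetAC.
  - exact: half3_le.
  by [].
have ov : ordat (3 * m)./2 (q (tet u v a) - q (tet u v b)) (moment (x v)).
  rewrite [tet u v a]tetCA [tet u v b]tetCA.
  by apply: vertex; rewrite is_tetCA.
apply: ordplane_le (ordat_line (hB _ _) (vertex u v ta tb) ov).
by apply: half3_sum; apply: leq_trans dn _; rewrite leq_mul2l.
Qed.

(** Some vertex [a] of the link has degree three, with neighbours y, z, w; the fifth vertex [b] is
    then the apex of the second triangle on each edge opposite to [a]. *)
Lemma bipyramid_link : #|V| = 6 -> exists a b y z w,
  [/\ uniq [:: gamma; a; b; y; z; w],
      [/\ is_tet a y z, is_tet a y w & is_tet a z w] &
      [/\ is_tet b y z, is_tet b y w & is_tet b z w]].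
Proof.
move=> V6.
have /card_gt0P [u] : (0 < #|[set~ gamma]|)%N by rewrite cardsC1 V6.
rewrite !inE => ug.
have [a [y [z [w [ayz ayw azw]]]]] : exists a y z w,
    [/\ is_tet a y z, is_tet a y w & is_tet a z w].
  have [a [b t]] := nbr_exists HL ug.
  have [c [cb tc _]] := link_two HL t.
  have tb : is_tet u b a by rewrite is_tetAC.
  have [e [ea te _]] := link_two HL tb.
  have [[_ ag bg] [ua ub ab]] := is_tet_neq t.
  have [[_ _ cg] [_ uc ac]] := is_tet_neq tc.
  have [[_ _ eg] [_ ue be]] := is_tet_neq te.
  have [ec|ec] := eqVneq e c; first by exists u, a, b, c; rewrite -{2}ec.
  have ul : uniq [:: gamma; u; a; b; c; e].
    rewrite /= !inE !negb_or ![gamma == _]eq_sym ug ag bg cg eg ua ub uc ue ab ac be.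
    by rewrite (eq_sym a) ea (eq_sym b) cb (eq_sym c) ec.
  have cov := cover_list ul (esym V6).
  (* The second triangle on {a, b} has apex c or e, and closes the link of a or b. *)
  have tab : is_tet a b u by rewrite is_tetAC is_tetCA.
  have [f [fu tf _]] := link_two HL tab; have [[_ _ fg] [_ af bf]] := is_tet_neq tf.
  have := cov f; rewrite !inE (negbTE fg) (negbTE fu) (eq_sym f a) (negbTE af).
  rewrite (eq_sym f b) (negbTE bf) /= => /orP [] /eqP fE; rewrite fE in tf.
    by exists a, u, b, c; split=> //; rewrite is_tetCA.
  exists b, u, a, e; split; last by rewrite is_tetCA.
    by rewrite is_tetCA.
  by rewrite is_tetCA.
have [[ag yg zg] [ay az yz]] := is_tet_neq ayz.
have [[_ _ wg] [_ aw yw]] := is_tet_neq ayw; have [_ [_ _ zw]] := is_tet_neq azw.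
have u5 : uniq [:: gamma; a; y; z; w].
  by rewrite /= !inE !negb_or ![gamma == _]eq_sym ag yg zg wg ay az aw yz yw zw.
have [b] : exists b, b \notin [:: gamma; a; y; z; w].
  apply: contrapT => none; suff VE : #|V| = 5 by rewrite VE in V6.
  rewrite -[RHS](card_uniqP u5); apply: eq_card => v; apply/esym.
  by apply: contrapT => /negP nv; apply: none; exists v.
rewrite !inE !negb_or => /and5P [bg ba byy bz bw].
(* If the second triangle on {y', z'} had apex w', the links of a and y' would be triangles missing
   [b]. Then [b] would have at most the neighbours z' and w', but a link of a vertex has at least
   three. *)
have H y' z' w' : is_tet a y' z' -> is_tet a y' w' -> is_tet a z' w' ->
    uniq [:: gamma; b; a; y'; z'; w'] -> is_tet b y' z'.
  move=> tyz tyw tzw u6; have cov := cover_list u6 (esym V6).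
  have [[_ yg' zg'] [ay' az' yz']] := is_tet_neq tyz.
  have t1 : is_tet y' z' a by rewrite is_tetAC is_tetCA.
  have [f [fa tf _]] := link_two HL t1; have [[_ _ fg] [_ yf zf]] := is_tet_neq tf.
  have := cov f; rewrite !inE (negbTE fg) (negbTE fa) (eq_sym f y') (negbTE yf).
  rewrite (eq_sym f z') (negbTE zf) /= => /orP [] /eqP fE; rewrite fE in tf.
    by rewrite is_tetAC is_tetCA in tf.
  have only v v1 v2 v3 : is_tet v v1 v2 -> is_tet v v2 v3 -> is_tet v v1 v3 ->
      b \notin [:: v1; v2; v3] -> ~~ nbr b v.
    by move=> h1 h2 h3; apply: contra => nb; apply: (link_triangle HL h1 h2 h3); rewrite nbrC.
  have : (b \notin [:: a; y'; z'; w']) by move: u6 => /= /and3P [].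
  rewrite !inE !negb_or => /and4P [ba' by' bz' bw'].
  have nba : ~~ nbr b a by apply: (only a y' z' w') => //; rewrite !inE !negb_or by' bz' bw'.
  have nby : ~~ nbr b y'.
    apply: (only y' a z' w'); rewrite ?inE ?negb_or ?ba' ?bz' ?bw' //; by rewrite is_tetCA.
  have [p [r tpr]] := nbr_exists HL bg; have [r' [r'r tpr' _]] := link_two HL tpr.
  have mem v v' : is_tet b v v' -> v \in [:: z'; w'].
    move=> tv; have [[_ vg _] [bv _ _]] := is_tet_neq tv.
    have vn := is_tet_nbr tv; have := cov v; rewrite !inE (negbTE vg) (eq_sym v b) (negbTE bv) /=.
    by case/or3P => [/eqP e|/eqP e|//]; [rewrite e (negbTE nba) in vn | rewrite e (negbTE nby) in vn].
  have [_ [_ _ pr]] := is_tet_neq tpr; have [_ [_ _ pr']] := is_tet_neq tpr'.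
  have rm : r \in [:: z'; w'] by apply: (mem _ p); rewrite is_tetAC.
  have rm' : r' \in [:: z'; w'] by apply: (mem _ p); rewrite is_tetAC.
  move: (mem _ _ tpr) rm rm' pr pr' r'r; rewrite !inE.
  by do 3 (case/orP => /eqP ->); rewrite ?eqxx.
have uH l : perm_eq l [:: y; z; w] -> uniq [:: gamma, b, a & l].
  move=> lp; rewrite !cons_uniq (perm_uniq lp) !inE !(perm_mem lp) !inE !negb_or.
  rewrite ![gamma == _]eq_sym bg ag yg zg wg ba byy bz bw ay az aw /=.
  by rewrite !inE !negb_or yz yw zw.
exists a, b, y, z, w; split; last 1 first.
- split; [apply: (H _ _ w) | apply: (H _ _ z) | apply: (H _ _ y)].
  + by [].
  + by [].
  + by [].
  + exact: uH.
  + by [].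
  + by [].
  + by rewrite is_tetAC.
  + by apply: uH; rewrite perm_cons (perm_catC [:: w] [:: z]).
  + by [].
  + by rewrite is_tetAC.
  + by rewrite is_tetAC.
  + by apply: uH; rewrite (perm_catC [:: z; w] [:: y]).
- have := uH [:: y; z; w] (perm_refl _); apply: etrans.
  apply: perm_uniq; rewrite perm_cons (perm_catCA [:: a] [:: b]).
  by [].
- by [].
Qed.

(** Order n1 across the triangles at the apexes, n2 across those on the equator. They are kept apart
    because the bootstrap raises them in turn. *)
Definition bipyramid_smooth n1 n2 a b y z w := forall u v t,
  perm_eq [:: u; v; t] [:: y; z; w] ->
  [/\ opl n1 (q (tet a t v) - q (tet a t u)) a t,
      opl n1 (q (tet b t v) - q (tet b t u)) b t &
      opl n2 (q (tet u v a) - q (tet u v b)) u v].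

Lemma bipyramid_smooth_sym n1 n2 a b y z w :
  bipyramid_smooth n1 n2 a b y z w -> bipyramid_smooth n1 n2 b a y z w.
Proof.
move=> H u v t p; have [h1 h2 h3] := H u v t p; split=> //.
by rewrite -opprB; apply: ordplaneN.
Qed.

(** Around the ray of [t] there are four tetrahedra, separated by the planes through a, u, b, v with
    orders n1, n2, n1, n2. *)
Lemma bipyramid_equator s n1 n2 a b y z w : uniq [:: a; b; y; z; w] ->
  bipyramid_smooth n1 n2 a b y z w ->
  (3 * s <= 2 * n1 + 2 * n2)%N -> (s <= 2 * n1)%N -> (s <= 2 * n2)%N ->
  forall u v t, perm_eq [:: u; v; t] [:: y; z; w] ->
  ordat s (q (tet a t v) - q (tet a t u)) (moment (x t)) /\
  ordat s (q (tet t u a) - q (tet t u b)) (moment (x t)).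
Proof.
move=> ul H s12 s1 s2 u v t p.
have p1 : perm_eq [:: t; u; v] [:: y; z; w].
  by apply: perm_trans p; rewrite (perm_catC [:: t] [:: u; v]).
have p2 : perm_eq [:: v; t; u] [:: y; z; w].
  by apply: perm_trans p; rewrite (perm_catC [:: v; t] [:: u]).
have [h1 h2 _] := H _ _ _ p; have [_ _ h3] := H _ _ _ p1; have [_ _ h4] := H _ _ _ p2.
have hneg n g x1 x2 : ordplane n g x1 x2 -> ordplane n (- g) x2 x1.
  by move=> h; apply/ordplaneN/ordplane_sym.
have tt c1 c2 c3 : tet c1 c2 c3 = tet c2 c3 c1 by rewrite tetCA tetAC.
have [] := @moment_vertex4 d n1 n2 s t a u b v (q (tet a t v)) (q (tet a t u))
    (q (tet b t u)) (q (tet b t v)).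
- rewrite (perm_uniq (perm_bipyramid t a u b v)).
  by rewrite (perm_uniq (_ : perm_eq _ [:: a; b; y; z; w])) // !perm_cons.
- exact: hq.
- exact: hq.
- exact: hq.
- exact: hq.
- exact: ordplane_sym.
- by rewrite [tet a t u]tt [tet b t u]tt.
- by rewrite -opprB; apply: hneg.
- by rewrite -opprB [tet a t v]tt [tet b t v]tt [tet t v a]tetCA [tet t v b]tetCA; apply: hneg.
- by [].
- by [].
- by [].
by rewrite [tet a t u]tt [tet b t u]tt.
Qed.

Lemma bipyramid_apex s n1 n2 a b y z w : uniq [:: a; b; y; z; w] ->
  bipyramid_smooth n1 n2 a b y z w -> (2 * s <= 3 * n1)%N ->
  forall u v t, perm_eq [:: u; v; t] [:: y; z; w] ->
  ordat s (q (tet a t v) - q (tet a t u)) (moment (x a)).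
Proof.
move=> ul H s1 u v t p.
have p1 : perm_eq [:: t; u; v] [:: y; z; w].
  by apply: perm_trans p; rewrite (perm_catC [:: t] [:: u; v]).
have p2 : perm_eq [:: v; t; u] [:: y; z; w].
  by apply: perm_trans p; rewrite (perm_catC [:: v; t] [:: u]).
have [h1 _ _] := H _ _ _ p; have [h2 _ _] := H _ _ _ p2; have [h3 _ _] := H _ _ _ p1.
have [] := @moment_vertex3 d n1 s a t u v (q (tet a t v)) (q (tet a t u)) (q (tet a u v)).
- have u5 : uniq [:: a; b; u; v; t].
    by rewrite (perm_uniq (_ : perm_eq _ [:: a; b; y; z; w])) // !perm_cons.
  move: u5; rewrite -(perm_uniq (perm_bipyramid t a u b v)).
  rewrite /= !inE !negb_or !andbT -!andbA => /and5P [ta tu tb tv /and5P [au ab av ub uv]].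
  by rewrite eq_sym ta au av tu tv (andP uv).1.
- exact: hq.
- exact: hq.
- exact: hq.
- exact: h1.
- by rewrite [tet a t u]tetAC.
- by rewrite [tet a u v]tetAC [tet a t v]tetAC.
- by [].
by [].
Qed.

(** First the apex triangles gain, from orders 3n/2 at the apex and 4n/3 on the equator. Their new
    order n + 1 raises the equator rays to (4n+2)/3, and then the equator triangles gain. *)
Lemma bipyramid_step n a b y z w : uniq [:: a; b; y; z; w] -> (3 * d + 3 <= 5 * n)%N ->
  bipyramid_smooth n n a b y z w -> bipyramid_smooth n.+1 n.+1 a b y z w.
Proof.
move=> ul dn H.
have apex a' b' : uniq [:: a'; b'; y; z; w] -> bipyramid_smooth n n a' b' y z w ->
    forall u v t, perm_eq [:: u; v; t] [:: y; z; w] ->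
    opl n.+1 (q (tet a' t v) - q (tet a' t u)) a' t.
  move=> ul' H' u v t p; apply: ordplane_le (bipyramid_apex_sum dn) _.
  apply: ordat_line (hB _ _) (bipyramid_apex ul' H' (half3_le n) p) _.
  have [c1 c2] := bipyramid_equator_bounds n.
  by have [] := bipyramid_equator ul' H' c1 c2 c2 p.
have ulba : uniq [:: b; a; y; z; w].
  move: ul; apply: etrans; apply: perm_uniq.
  by rewrite (perm_catCA [:: b] [:: a]).
have H1 : bipyramid_smooth n.+1 n a b y z w.
  move=> u v t p; split; last by case: (H u v t p).
    exact: apex ul H _ _ _ p.
  exact: apex ulba (bipyramid_smooth_sym H) _ _ _ p.
move=> u v t p; have [h1 h2 _] := H1 u v t p; split; [exact: h1 | exact: h2 |].
apply: ordplane_le (bipyramid_equator_sum dn) _.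
have n0 : (0 < n)%N by clear -dn; lia.
have [c1 c2 c3] := bipyramid_equator_bounds' n0.
have eqt := bipyramid_equator ul H1 c1 c2 c3.
apply: ordat_line (hB _ _) _ _.
  have p' : perm_eq [:: v; t; u] [:: y; z; w].
    by apply: perm_trans p; rewrite (perm_catC [:: v; t] [:: u]).
  by have [] := eqt _ _ _ p'.
have p' : perm_eq [:: u; t; v] [:: y; z; w].
  by apply: perm_trans p; rewrite perm_cons (perm_catC [:: t] [:: v]).
by have [_] := eqt _ _ _ p'; rewrite [tet u v a]tetCA [tet u v b]tetCA.
Qed.

(** After d + 1 rounds all jumps vanish; it remains to see that every tetrahedron contains an
    apex. *)
Lemma bipyramid_const n : #|V| = 6 -> (3 * d + 3 <= 5 * n)%N -> smoothx n ->
  forall S T, S \in tetrahedra Delta -> T \in tetrahedra Delta -> q S = q T.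
Proof.
move=> V6 dn sm; have [a [b [y [z [w [u6 [ayz ayw azw] [byz byw bzw]]]]]]] := bipyramid_link V6.
have ul : uniq [:: a; b; y; z; w] by move: u6 => /= /andP [].
have all c : is_tet c y z -> is_tet c y w -> is_tet c z w ->
    forall u v t, perm_eq [:: u; v; t] [:: y; z; w] ->
    [/\ is_tet c u v, is_tet c u t & is_tet c v t].
  move=> cyz cyw czw; apply: perm3_ind; last by split.
    by move=> u v t [h1 h2 h3]; split=> //; rewrite is_tetAC.
  by move=> u v t [h1 h2 h3]; split=> //; rewrite is_tetAC.
have H0 : bipyramid_smooth n n a b y z w.
  move=> u v t p; have [auv aut avt] := all a ayz ayw azw _ _ _ p.
  have [buv but bvt] := all b byz byw bzw _ _ _ p.
  split; apply: sm.
  - by rewrite is_tetAC.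
  - by rewrite is_tetAC.
  - by rewrite is_tetAC.
  - by rewrite is_tetAC.
  - by rewrite is_tetAC is_tetCA.
  - by rewrite is_tetAC is_tetCA.
have Hk k : bipyramid_smooth (n + k) (n + k) a b y z w.
  elim: k => [|k IH]; rewrite ?addn0 // addnS; apply: bipyramid_step => //.
  by apply: leq_trans dn _; rewrite leq_mul2l leq_addr.
have eq0 S T u v : opl (n + d.+1) (q S - q T) u v -> q S = q T.
  move=> o; apply/eqP; rewrite -subr_eq0; apply/eqP; apply: ordat_gt_eq0 (hB _ _) _.
  exact: (ordplane_le (leq_addl _ _) o 0 0).
pose Q := q (tet a y z).
have E u v t : perm_eq [:: u; v; t] [:: y; z; w] ->
    [/\ q (tet a t v) = q (tet a t u), q (tet b t v) = q (tet b t u) &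
        q (tet u v a) = q (tet u v b)].
  by move=> p; have [/eq0 h1 /eq0 h2 /eq0 h3] := Hk d.+1 u v t p.
have p1 : perm_eq [:: z; w; y] [:: y; z; w] by rewrite (perm_catC [:: z; w] [:: y]).
have p2 : perm_eq [:: y; w; z] [:: y; z; w] by rewrite perm_cons (perm_catC [:: w] [:: z]).
have [Ea1 Eb1 _] := E _ _ _ p1; have [Ea2 Eb2 _] := E _ _ _ p2.
have [_ _ Eab] := E _ _ _ (perm_refl _).
have tt c1 c2 c3 : tet c1 c2 c3 = tet c2 c3 c1 by rewrite tetCA tetAC.
have Qb : q (tet b y z) = Q by rewrite tt -Eab -tt.
have around c : is_tet c y z -> is_tet c y w -> is_tet c z w -> q (tet c y z) = Q ->
    q (tet c y w) = q (tet c y z) -> q (tet c z w) = q (tet c z y) ->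
    forall T, T \in tetrahedra Delta -> c \in T -> q T = Q.
  move=> cyz cyw czw e1 e2 e3 T Tt cT; have [[cg _ _] _] := is_tet_neq cyz.
  have [p [r TE]] := tet_of_vertex (link_center HL) Tt cT cg.
  have tpr : is_tet c p r by rewrite /is_tet -TE.
  have np : p \in [:: y; z; w] := link_triangle HL cyz czw cyw (is_tet_nbr tpr).
  have nr : r \in [:: y; z; w].
    by apply: (link_triangle HL cyz czw cyw); apply: (@is_tet_nbr _ _ _ _ _ p); rewrite is_tetAC.
  have [_ [_ _ pr]] := is_tet_neq tpr; rewrite TE.
  have e4 : q (tet c z w) = Q by rewrite e3 tetAC.
  have e5 : q (tet c y w) = Q by rewrite e2.
  move: np nr pr; rewrite !inE => /or3P [] /eqP -> /or3P [] /eqP ->; rewrite ?eqxx // => _.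
  - by rewrite tetAC.
  - by rewrite tetAC.
  - by rewrite tetAC.
suff all_Q T : T \in tetrahedra Delta -> q T = Q by move=> S T /all_Q -> /all_Q ->.
move=> Tt; case: (boolP (a \in T)) => aT; first by apply: (around a).
case: (boolP (b \in T)) => bT; first by apply: (around b).
have cov := cover_list u6 (esym V6).
(* A tetrahedron without apex would give a third triangle on the edge {y, z}. *)
have TE : T = tet y z w.
  apply/eqP; rewrite eqEcard; apply/andP; split; last first.
    have := Tt; rewrite inE => /andP [_ /eqP ->].
    have -> : tet y z w = [set v in [:: gamma; y; z; w]] by apply/setP => v; rewrite !inE -!orbA.
    by rewrite cardsE (leq_trans (card_size _)).
  apply/fintype.subsetP => v vT; have := cov v; rewrite !inE -!orbA.
  have /negbTE -> : v != a by apply: contraNneq aT => <-.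
  by have /negbTE -> : v != b by apply: contraNneq bT => <-.
have tyzw : is_tet y z w by rewrite /is_tet -TE.
have rot c : is_tet c y z -> is_tet y z c by rewrite is_tetCA is_tetAC.
have [f [_ _ uq]] := link_two HL (rot _ ayz).
have ba : b != a by move: ul => /= /andP []; rewrite inE negb_or eq_sym => /andP [].
have aw : w != a by apply: contraNneq aT => <-; rewrite TE !inE eqxx orbT.
have bw : w != b by apply: contraNneq bT => <-; rewrite TE !inE eqxx orbT.
case: (uq _ (rot _ byz)) => [e|bf]; first by rewrite e eqxx in ba.
by case: (uq _ tyzw) => [e|wf]; [rewrite e eqxx in aw | rewrite wf -bf eqxx in bw].
Qed.
End RigidExamples.

(** * Geometry of closed vertex stars *)

(** With n = r + 1 the three bounds on d read d + 2 <= 2 n, 3 d + 3 <= 5 n and 2 d + 2 <= 3 n. *)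
Lemma exists_rigid_D_gamma (R : realType) (V : finType) (Delta : {set {set V}})
    (gamma : V) r d : closed_link Delta gamma -> (4 < #|V|)%N ->
  (d <= D_gamma #|V|.-1 r)%N ->
  exists2 p : V -> 'rV[R]_3, p gamma = 0 & rigid_at Delta gamma r.+1 d p.
Proof.
move=> HL V5; rewrite /D_gamma.
have V0 : (0 < #|V|)%N by apply: leq_trans V5.
pose x (v : V) : R := (enum_rank v)%:R.
have x_inj : injective x.
  by move=> u v /eqP; rewrite eqr_nat => /eqP /val_inj /enum_rank_inj.
pose p v : 'rV[R]_3 := if v == gamma then 0 else moment (x v).
have moment_rigid : (forall q : {set V} -> mpoly 3 R, (forall T, homogeneous d (q T)) ->
    smooth Delta gamma r.+1 (fun u _ => moment (x u)) (fun _ v => moment (x v)) q ->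
    forall S T, S \in tetrahedra Delta -> T \in tetrahedra Delta -> q S = q T) ->
    exists2 p : V -> 'rV[R]_3, p gamma = 0 & rigid_at Delta gamma r.+1 d p.
  move=> H; exists p; first by rewrite /p eqxx.
  apply: rigid_span H => u v a t X Y; exists X, Y.
  by have [[/negbTE ug /negbTE vg _] _] := is_tet_neq t; rewrite /p ug vg.
case: eqP => [V4|_].
  have V5' : #|V| = 5 by rewrite -(prednK V0) V4.
  move=> dr; apply: moment_rigid => q hq; apply: (tetrahedron_const HL x_inj hq V5').
  by clear -dr; lia.
case: eqP => [V4|_].
  have V6' : #|V| = 6 by rewrite -(prednK V0) V4.
  move=> dr; apply: moment_rigid => q hq; apply: (bipyramid_const HL x_inj hq V6').
  by clear -dr; lia.
move=> dr; apply: exists_rigid => //; first exact: ltnW.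
by clear -dr; lia.
Qed.

(** Lets the inequality of [num_interior_edges_ge] carry the bound on d over to the number of
    vertices of the link. *)
Lemma D_gamma_antitone r m n : (3 < m)%N -> (m <= n)%N -> (D_gamma n r <= D_gamma m r)%N.
Proof.
rewrite /D_gamma => m4 mn.
by do ![case: eqP => ?]; lia.
Qed.

Section Basis.
Variable R : comUnitRingType.
Implicit Types a b c : 'rV[R]_3.

Definition mat3 a b c : 'M[R]_3 := \matrix_i nth a [:: a; b; c] i.

Lemma mul_vec_mat3 (x y z : R) a b c :
  vec x y z *m mat3 a b c = x *: a + y *: b + z *: c.
Proof.
by rewrite mulmx_sum_row !big_ord_recl big_ord0 !rowK !mxE /= addr0 addrA.
Qed.
End Basis.

Lemma map_mat3 (R S : comUnitRingType) (f : R -> S) (a b c : 'rV[R]_3) :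
  map_mx f (mat3 a b c) = mat3 (map_mx f a) (map_mx f b) (map_mx f c).
Proof. by apply/matrixP => -[[|[|[|//]]] i3] j; rewrite !mxE. Qed.

Section Independence.
Variables (R : realType).
Implicit Types a b c w : 'rV[R]_3.

Definition independent3 a b c :=
  forall x y z : R, x *: a + y *: b + z *: c = 0 -> [/\ x = 0, y = 0 & z = 0].

Lemma independent3P a b c : independent3 a b c <-> mat3 a b c \in unitmx.
Proof.
split=> [li|Mu x y z].
  rewrite -row_free_unit; apply: inj_row_free => v.
  rewrite [v]vecE mul_vec_mat3 => /li [-> -> ->].
  by apply/rowP => -[[|[|[|//]]] i3]; rewrite !mxE.
rewrite -mul_vec_mat3 => /(congr1 (mulmx^~ (invmx (mat3 a b c)))).
rewrite mulmxK // mul0mx => /rowP e.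
by have := e ord0; have := e (inord 1); have := e (inord 2); rewrite !mxE /= !inordK.
Qed.

Lemma vectors_basis a b c : independent3 a b c ->
  forall w, exists x y z, w = x *: a + y *: b + z *: c.
Proof.
move=> /independent3P Mu w; rewrite -[w](mulmxKV Mu) [w *m _]vecE mul_vec_mat3.
by do 3 eexists.
Qed.
End Independence.

(** * Cones over the tetrahedra *)

Section Geometry.
Variables (R : realType) (V : finType) (Delta : {set {set V}}) (p : V -> 'rV[R]_3)
  (gamma : V).
Hypothesis hstar : vertex_star Delta p gamma.
Local Notation E := 'rV[R]_3.
Local Notation tet := (tet gamma).
Local Notation is_tet := (is_tet Delta gamma).

(** The cone from the origin; the weight at [gamma] has no effect, as [gamma] sits at 0. *)
Definition cone (T : {set V}) (x : E) := exists w : V -> R,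
  [/\ forall v, 0 <= w v, forall v, v \notin T -> w v = 0 & x = \sum_v w v *: p v].

Lemma hull_cone T x : hull p T x -> cone T x.
Proof. by case=> w [w0 wT _ xE]; exists w. Qed.

Lemma hullS (S T : {set V}) : S \subset T -> (hull p S `<=` hull p T)%classic.
Proof.
move=> ST x [w [w0 wS w1 xE]]; exists w; split=> // v vT; apply: wS.
by apply: contra vT; apply: (fintype.subsetP ST).
Qed.

Lemma tet_center T : T \in tetrahedra Delta -> gamma \in T.
Proof. exact: (star_center hstar). Qed.

Lemma p_center : p gamma = 0. Proof. exact: (star_origin hstar). Qed.

Lemma cone_hull (T : {set V}) (w : V -> R) (s : R) : gamma \in T ->
  (forall v, 0 <= w v) -> (forall v, v \notin T -> w v = 0) ->
  0 <= s -> s * (\sum_(v | v != gamma) w v) <= 1 ->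
  hull p T (s *: \sum_v w v *: p v).
Proof.
move=> gT w0 wT s0 s1.
exists (fun v => if v == gamma then 1 - s * \sum_(v | v != gamma) w v else s * w v); split.
- by move=> v; case: ifP => _; [rewrite subr_ge0 | apply: mulr_ge0].
- by move=> v vT; case: eqP => [e|_]; [rewrite e gT in vT | rewrite wT // mulr0].
- rewrite (bigD1 gamma) //= eqxx [X in _ + X](eq_bigr (fun v => s * w v)); last by move=> v /negbTE ->.
  by rewrite -mulr_sumr subrK.
- rewrite scaler_sumr; apply: eq_bigr => v _; case: eqP => [->|_]; last by rewrite scalerA.
  by rewrite p_center !scaler0.
Qed.

(** Shrinking [x] towards [gamma] puts it into both hulls, where the embedding condition applies. *)
Lemma coneI (S T : {set V}) x : S \in tetrahedra Delta -> T \in tetrahedra Delta ->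
  cone S x -> cone T x -> cone (S :&: T)%SET x.
Proof.
move=> St Tt [w [w0 wS xE]] [w' [w'0 w'T xE']].
pose A (u : V -> R) := \sum_(v | v != gamma) u v.
have A0 u : (forall v, 0 <= u v) -> 0 <= A u by move=> u0; apply: sumr_ge0.
pose s := (1 + A w + A w')^-1.
have D0 : 0 < 1 + A w + A w' by rewrite ltr_wpDr ?A0 // ltr_wpDr ?A0.
have s0 : 0 < s by rewrite invr_gt0.
have hS : hull p S (s *: x).
  rewrite xE; apply: cone_hull => //; [exact: tet_center | exact: ltW |].
  by rewrite mulrC ler_pdivrMr // mul1r; have := A0 _ w'0; rewrite -/(A w); lra.
have hT : hull p T (s *: x).
  rewrite xE'; apply: cone_hull => //; [exact: tet_center | exact: ltW |].
  by rewrite mulrC ler_pdivrMr // mul1r; have := A0 _ w0; rewrite -/(A w'); lra.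
have [_ emb] := star_embedded hstar.
have inD U : U \in tetrahedra Delta -> U \in Delta by rewrite inE => /andP [].
have : hull p (S :&: T)%SET (s *: x) by rewrite -(emb S T (inD _ St) (inD _ Tt)).
case/hull_cone => u [u0 uI uE]; exists (fun v => s^-1 * u v); split.
- by move=> v; rewrite mulr_ge0 // invr_ge0 ltW.
- by move=> v /uI ->; rewrite mulr0.
- rewrite -[x](scalerK (lt0r_neq0 s0)) uE scaler_sumr; apply: eq_bigr => v _.
  by rewrite scalerA.
Qed.

Lemma sum_tet u v a (w : V -> R) : is_tet u v a ->
  (forall y, y \notin tet u v a -> w y = 0) ->
  \sum_y w y *: p y = w u *: p u + w v *: p v + w a *: p a.
Proof.
move=> t w0; have [[ug vg ag] [uv ua va]] := is_tet_neq t.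
rewrite (bigD1 u) //= (bigD1 v) ?(eq_sym v) //= (bigD1 a) ?(eq_sym a) ?ua //=.
rewrite big1 ?addr0 ?addrA // => y /andP [/andP [yu yv] ya].
have [->|yg] := eqVneq y gamma; first by rewrite p_center scaler0.
by rewrite w0 ?scale0r // !inE !negb_or yg yu yv ya.
Qed.

Lemma tet_li u v a : is_tet u v a ->
  independent3 (p u) (p v) (p a).
Proof.
move=> t x y z e; have [[ug vg ag] [uv ua va]] := is_tet_neq t.
have [aff _] := star_embedded hstar.
have tD : tet u v a \in Delta by move: t; rewrite /is_tet inE => /andP [].
pose w b := if b == u then x else if b == v then y else if b == a then z else
  if b == gamma then - (x + y + z) else 0.
have vu : v == u = false by rewrite eq_sym (negbTE uv).
have au : a == u = false by rewrite eq_sym (negbTE ua).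
have av : a == v = false by rewrite eq_sym (negbTE va).
have wu : w u = x by rewrite /w eqxx.
have wv : w v = y by rewrite /w vu eqxx.
have wa : w a = z by rewrite /w au av eqxx.
have wg : w gamma = - (x + y + z).
  by rewrite /w !(eq_sym gamma) (negbTE ug) (negbTE vg) (negbTE ag) eqxx.
have w0 b : b \notin tet u v a -> w b = 0.
  by rewrite !inE !negb_or /w -!andbA => /and4P [/negbTE -> /negbTE -> /negbTE -> /negbTE ->].
have := aff _ tD w; move=> H.
have sum0 : \sum_(b in tet u v a) w b = 0.
  rewrite big_mkcond (eq_bigr w); last by move=> b _; case: ifP => // /negbT/w0.
  rewrite (bigD1 gamma) //= (bigD1 u) //= (bigD1 v) ?vg ?vu //= (bigD1 a) ?ag ?au ?av //=.
  rewrite big1 ?wg ?wu ?wv ?wa; first by ring.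
  by move=> b /andP [/andP [/andP [bg bu] bv] ba]; rewrite w0 // !inE !negb_or bg bu bv ba.
have sumE : \sum_(b in tet u v a) w b *: p b = 0.
  rewrite big_mkcond (eq_bigr (fun b => w b *: p b)).
    by rewrite (sum_tet t w0) wu wv wa.
  by move=> b _; case: ifP => // /negbT/w0 ->; rewrite scale0r.
have {}H := H sum0 sumE; rewrite -wu -wv -wa.
by split; apply: H; rewrite !inE eqxx ?orbT.
Qed.

Lemma tet_span u v a : is_tet u v a -> forall w, exists x y z : R,
  w = x *: p u + y *: p v + z *: p a.
Proof. by move=> t; apply: vectors_basis; apply: tet_li. Qed.

Lemma cone_tetP u v a (x y z : R) : is_tet u v a ->
  0 <= x -> 0 <= y -> 0 <= z -> cone (tet u v a) (x *: p u + y *: p v + z *: p a).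
Proof.
move=> t x0 y0 z0; have [[ug vg ag] [uv ua va]] := is_tet_neq t.
pose w b := if b == u then x else if b == v then y else if b == a then z else 0.
have vu : v == u = false by rewrite eq_sym (negbTE uv).
have au : a == u = false by rewrite eq_sym (negbTE ua).
have av : a == v = false by rewrite eq_sym (negbTE va).
have w0 b : b \notin tet u v a -> w b = 0.
  by rewrite !inE !negb_or /w -!andbA => /and4P [_ /negbTE -> /negbTE -> /negbTE ->].
exists w; split=> //.
  by move=> b; rewrite /w; do 3 (case: ifP => _ //).
by rewrite (sum_tet t w0) /w eqxx vu eqxx au av eqxx.
Qed.

Lemma tet_coef u v a (x y z x' y' z' : R) : is_tet u v a ->
  x *: p u + y *: p v + z *: p a = x' *: p u + y' *: p v + z' *: p a ->
  [/\ x = x', y = y' & z = z'].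
Proof.
move=> t /eqP; rewrite -subr_eq0 => /eqP e.
have /(tet_li t) [] : (x - x') *: p u + (y - y') *: p v + (z - z') *: p a = 0.
  by rewrite -e; apply/rowP => i; rewrite !mxE; ring.
by do 3 (move/eqP; rewrite subr_eq0 => /eqP ->).
Qed.

Lemma cone_tet_coef u v a (S : {set V}) (x y z : R) : is_tet u v a -> S \subset tet u v a ->
  cone S (x *: p u + y *: p v + z *: p a) ->
  [/\ 0 <= x, 0 <= y & 0 <= z] /\
  [/\ u \notin S -> x = 0, v \notin S -> y = 0 & a \notin S -> z = 0].
Proof.
move=> t ST [w [w0 wS]]; rewrite (sum_tet t); last first.
  by move=> b bT; apply: wS; apply: contra bT; apply: (fintype.subsetP ST).
by case/(tet_coef t) => -> -> ->; split; split=> //; apply: wS.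
Qed.

(** If z >= 0, adding a large multiple of p u + p v to p b gives a point of both cones. It would lie
    in the cone of the intersection, yet its coefficient at [b] is 1. *)
Lemma opposite_sides u v a b (x y z : R) : is_tet u v a -> is_tet u v b -> a != b ->
  p b = x *: p u + y *: p v + z *: p a -> z < 0.
Proof.
move=> ta tb ab pb; rewrite ltNge; apply/negP => z0.
pose K := `|x| + `|y|; have K0 : 0 <= K by rewrite addr_ge0.
have Kx : 0 <= K + x by rewrite /K; have := ler_norm (- x); rewrite normrN; have := normr_ge0 y; lra.
have Ky : 0 <= K + y by rewrite /K; have := ler_norm (- y); rewrite normrN; have := normr_ge0 x; lra.
have cb : cone (tet u v b) (K *: p u + K *: p v + 1 *: p b) by apply: cone_tetP.
have ca : cone (tet u v a) (K *: p u + K *: p v + 1 *: p b).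
  have -> : K *: p u + K *: p v + 1 *: p b = (K + x) *: p u + (K + y) *: p v + z *: p a.
    by rewrite pb; apply/rowP => i; rewrite !mxE; ring.
  exact: cone_tetP.
have [_ [_ _]] := cone_tet_coef tb (subsetIr _ _) (coneI ta tb ca cb).
have [[_ _ bg] [_ ub vb]] := is_tet_neq tb.
have bn : b \notin tet u v a.
  by rewrite !inE !negb_or bg (eq_sym b) ub (eq_sym b) vb (eq_sym b) ab.
rewrite inE (negbTE bn) /= => /(_ isT) /eqP; exact/negP/oner_neq0.
Qed.

Lemma finite_lower_bound (I : finType) (K : realFieldType) (f : I -> K) :
  (forall i, 0 < f i) -> exists2 e : K, 0 < e & forall i, e <= f i.
Proof.
move=> f0; pose s := 1 + \sum_i (f i)^-1.
have s0 : 0 < s by rewrite ltr_wpDr // sumr_ge0 // => i _; rewrite invr_ge0 ltW.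
exists s^-1 => [|i]; first by rewrite invr_gt0.
rewrite -[f i]invrK lef_pV2 ?posrE ?invr_gt0 // /s (bigD1 i) //=.
rewrite addrCA lerDl addr_ge0 // sumr_ge0 // => j _; by rewrite invr_ge0 ltW.
Qed.

Hypothesis hclosed : closed_star Delta p gamma.

(** [gamma] is an interior point, so a small multiple of [x] lies in the realization. *)
Lemma cone_cover x : exists2 T, T \in tetrahedra Delta & cone T x.
Proof.
have : nbhs (0 : E) (realization Delta p) by have := hclosed; rewrite /closed_star p_center.
case/nbhs_ballP => e /= e0 sub; pose s := e / 2 / (`|x| + 1).
have n0 : 0 < `|x| + 1 by rewrite ltr_wpDl.
have s0 : 0 < s by rewrite !divr_gt0.
have [S /= SD] : realization Delta p (s *: x).
  apply: sub; rewrite -ball_normE /= sub0r normrN normrZ gtr0_norm //.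
  have : s * (`|x| + 1) = e / 2 by rewrite divfK ?gt_eqF.
  rewrite mulrDr mulr1; lra.
have [T Tt ST] := star_pure hstar SD.
move/(hullS ST) => /hull_cone [w [w0 wT xE]].
exists T => //; exists (fun v => s^-1 * w v); split.
- by move=> v; rewrite mulr_ge0 // invr_ge0 ltW.
- by move=> v /wT ->; rewrite mulr0.
- rewrite -[x](scalerK (lt0r_neq0 s0)) xE scaler_sumr; apply: eq_bigr => v _.
  by rewrite scalerA.
Qed.

Lemma affine_ge0 (a b : R) :
  (forall e, 0 < e -> exists t, [/\ 0 < t, t < e & 0 <= a - t * b]) -> 0 <= a.
Proof.
move=> H; rewrite leNgt; apply/negP => a0.
have [|t [t0 te h]] := H (- a / (`|b| + 1)).
  by rewrite divr_gt0 ?oppr_gt0 // ltr_wpDl.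
have n0 : 0 < `|b| + 1 by rewrite ltr_wpDl.
move: te; rewrite ltr_pdivlMr // => te.
have : - (t * b) <= t * `|b|.
  by rewrite -mulrN ler_pM2l // -normrN ler_norm.
lra.
Qed.

Lemma tet_of_center T : T \in tetrahedra Delta -> exists u v a, T = tet u v a.
Proof.
move=> Tt; have /card_gt0P [u] : (0 < #|T :\ gamma|)%N.
  have := Tt; rewrite inE => /andP [_].
  by rewrite (cardsD1 gamma T) (tet_center Tt) => /eqP; case: #|_|.
rewrite !inE => /andP [ug uT].
have [x [y ->]] := tet_of_vertex tet_center Tt uT ug.
by exists u, x, y.
Qed.

(** Push p u + p v slightly away from [a]. A tetrahedron whose cone contains such points for
    arbitrarily small pushes contains the limit, hence u and v. It cannot be [tet u v a], since the
    coefficient at [a] is negative. Finiteness and [cone_cover] provide one. *)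
Lemma second_tet u v a : is_tet u v a -> exists2 b, b != a & is_tet u v b.
Proof.
move=> t; apply: contrapT => none.
have only b : is_tet u v b -> b = a.
  by move=> tb; apply/eqP/negPn/negP => ba; apply: none; exists b.
pose x e := 1 *: p u + 1 *: p v + (- e) *: p a.
have away T : exists2 e : R, 0 < e & forall t, 0 < t -> t < e ->
    T \in tetrahedra Delta -> ~ cone T (x t).
  apply: contrapT => nT.
  have {}nT e : 0 < e -> exists t, [/\ 0 < t, t < e & T \in tetrahedra Delta /\ cone T (x t)].
    move=> e0; apply: contrapT => ne; apply: nT; exists e => // s s0 se Tt c.
    by apply: ne; exists s.
  have [_ [_ _ [Tt _]]] := nT 1 ltr01.
  have [b [c [f TE]]] := tet_of_center Tt; have tT : is_tet b c f by rewrite /is_tet -TE.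
  have [x1 [y1 [z1 E0]]] := tet_span tT (x 0).
  have [x2 [y2 [z2 Ea]]] := tet_span tT (p a).
  have xE s : x s = (x1 - s * x2) *: p b + (y1 - s * y2) *: p c + (z1 - s * z2) *: p f.
    have -> : x s = x 0 - s *: p a by apply/rowP => i; rewrite !mxE; ring.
    by rewrite E0 Ea; apply/rowP => i; rewrite !mxE; ring.
  have pos : [/\ 0 <= x1, 0 <= y1 & 0 <= z1].
    split; [apply: (@affine_ge0 _ x2) | apply: (@affine_ge0 _ y2) | apply: (@affine_ge0 _ z2)];
      move=> e /nT [s [s0 se [_]]]; rewrite TE xE => /(cone_tet_coef tT (subxx _)) [[h1 h2 h3] _];
      by exists s.
  have cT : cone T (x 0) by rewrite TE E0; case: pos => *; apply: cone_tetP.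
  have ct : cone (tet u v a) (x 0) by rewrite /x oppr0; apply: cone_tetP.
  have := coneI Tt t cT ct; rewrite /x => /(cone_tet_coef t (subsetIr _ _)) [_ [hu hv _]].
  have [[ug vg ag] [uv ua va]] := is_tet_neq t.
  have in1 w : (w \notin T :&: tet u v a -> 1 = 0 :> R) -> w \in T.
    move=> h; apply: contraT => nw; have : 1 = 0 :> R.
      by apply: h; rewrite inE (negbTE nw).
    by move/eqP; rewrite oner_eq0.
  have [a' TE'] := tet_of_edge tet_center Tt (in1 _ hu) (in1 _ hv) uv ug vg.
  have a'a : a' = a by apply: only; rewrite /is_tet -TE'.
  have [s [s0 _ [_]]] := nT 1 ltr01; rewrite TE' a'a.
  by case/(cone_tet_coef t (subxx _)) => [[_ _]]; rewrite oppr_ge0 leNgt s0.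
have /fin_all_exists2 [e e0 He] := away.
have [s s0 se] := finite_lower_bound e0.
have [T Tt cT] := cone_cover (x (s / 2)).
apply: (He T (s / 2)) cT => //; first by rewrite divr_gt0.
by apply: lt_le_trans (se T); rewrite ltr_pdivrMr // ltr_pMr // ltr1n.
Qed.

Lemma star_closed_link : closed_link Delta gamma.
Proof.
split; [exact: tet_center | exact: (star_hereditary hstar) | |].
- move=> u v a ta; have [b ba tb] := second_tet ta; exists b; split=> // c tc.
  have [->|ca] := eqVneq c a; first by left.
  have [->|cb] := eqVneq c b; first by right.
  have [x [y [z pb]]] := tet_span ta (p b); have [x' [y' [z' pc]]] := tet_span ta (p c).
  have z0 : z < 0 by apply: (opposite_sides ta tb _ pb); rewrite eq_sym.
  have z0' : z' < 0 by apply: (opposite_sides ta tc _ pc); rewrite eq_sym.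
  (* Three tetrahedra on one triangle are impossible: b and c are both opposite to a, so z'/z is
     positive, while b and c should be opposite to each other. *)
  have : z' / z < 0.
    apply: (@opposite_sides u v b c (x' - z' / z * x) (y' - z' / z * y)) => //; first by rewrite eq_sym.
    have zn : z != 0 by rewrite lt_eqF.
    by rewrite pc pb; apply/rowP => i; rewrite !mxE; field.
  by rewrite ltNge ltW // nmulr_lgt0 // invr_lt0.
- move=> v vg; have [_ D1 _] := star_complex hstar.
  have [T Tt vT] := star_pure hstar (D1 v).
  by exists T => //; move/fintype.subsetP: vT; apply; rewrite !inE.
Qed.

Lemma card_vertices_gt4 : (4 < #|V|)%N.
Proof.
have [D0 _ _] := star_complex hstar; have [T Tt _] := star_pure hstar D0.
have [u [v [a TE]]] := tet_of_center Tt; have t : is_tet u v a by rewrite /is_tet -TE.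
have [b ba tb] := second_tet t.
have [[ug vg ag] [uv ua va]] := is_tet_neq t; have [[_ _ bg] [_ ub vb]] := is_tet_neq tb.
have u5 : uniq [:: gamma; u; v; a; b].
  by rewrite /= !inE !negb_or ![gamma == _]eq_sym ug vg ag bg uv ua ub va vb eq_sym ba.
by have := max_card (mem [:: gamma; u; v; a; b]); rewrite (card_uniqP u5).
Qed.

(** Each edge {gamma, v} contains the interior point [gamma], so it is not in the boundary. *)
Lemma num_interior_edges_ge : (#|V|.-1 <= num_interior_edges Delta p)%N.
Proof.
rewrite -(cardsC1 gamma) /num_interior_edges.
rewrite -(@card_in_imset _ _ (fun v => [set gamma; v]%SET)).
  apply/subset_leq_card/fintype.subsetP => _ /imsetP [v vg ->].
  rewrite !inE in vg; have [T Tt vT] := link_cover star_closed_link vg.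
  have TD : T \in Delta by move: Tt; rewrite inE => /andP [].
  have [_ _ sub] := star_complex hstar; rewrite !inE; apply/and3P; split.
  - apply: sub TD _; apply/fintype.subsetP => y; rewrite !inE => /orP [] /eqP -> //.
    exact: tet_center.
  - by rewrite cards2 (eq_sym gamma) vg.
  - apply/negP => /asboolP h; have [|_ ] := h 0; last first.
      by apply; have := hclosed; rewrite /closed_star p_center.
    exists (fun y => (y == gamma)%:R); split.
    + by move=> y; rewrite ler0n.
    + by move=> y; rewrite !inE negb_or => /andP [/negbTE ->].
    + by rewrite (bigD1 gamma) //= eqxx big1 ?addr0 // => y /negbTE ->.
    + rewrite (bigD1 gamma) //= p_center scaler0 add0r big1 // => y /negbTE ->.
      by rewrite scale0r.
move=> v w; rewrite !inE => vg wg /setP /(_ v); rewrite !inE eqxx orbT (negbTE vg) /=.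
by move/esym/eqP.
Qed.
End Geometry.

(** * Polynomial and smooth functions *)

Section PolynomialFunctions.
Variable R : realType.
Local Notation E := 'rV[R]_3.
Implicit Types (q : mpoly 3 R) (x w : E).

Definition pfun q x : R := meval (x ord0) q.

Lemma mpoly3_ind (P : mpoly 3 R -> Prop) :
  P 1 -> (forall i q, P q -> P (mpolyX R (mnm1 i) * q)) -> P 0 ->
  (forall c p q, P p -> P q -> P (c *: p + q)) -> forall q, P q.
Proof.
move=> P1 PX P0 PD q; rewrite (mpolyE q).
have PM m : P (mpolyX R m).
  apply: (@homogeneous_ind R (fun _ => P) P1 (fun _ => PX) (fun _ => P0) (fun _ => PD) (mdeg m)).
  by rewrite /homogeneous dhomogX.
elim: (msupp q) => [|m s IH]; first by rewrite big_nil.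
by rewrite big_cons; apply: PD.
Qed.

Lemma lin1 x w : lin 1 x w = 1.
Proof. by rewrite /lin -mpolyC1 mmapC. Qed.

Lemma lin_mulX i q x w :
  lin (mpolyX R (mnm1 i) * q) x w = ((x ord0 i)%:P + (w ord0 i)%:P * 'X) * lin q x w.
Proof. by rewrite /lin rmorphM /= mmapX mmap1U. Qed.

Lemma deriv_lin q x w : (lin q x w)^`() = \sum_i (w ord0 i) *: lin (mderiv i q) x w.
Proof.
move: q; apply: mpoly3_ind.
- rewrite lin1 -polyC1 derivC big1 // => i _.
  by rewrite -mpolyC1 mderivC lin0 scaler0.
- move=> i q IH; rewrite lin_mulX derivM IH.
  have XE j : mderiv j (mpolyX R (mnm1 i)) = ((i == j)%:R : R) *: 1.
    rewrite mderivX mnm1E; case: eqP => [->|_]; last by rewrite !scale0r.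
    rewrite [mnm_sub _ _](_ : _ = @mnm0 3) ?mpolyX0 //.
    by apply/mnmP => k; rewrite mnmBE mnm0E subnn.
  under [RHS]eq_bigr => j _ do rewrite mderivM linD lin_mulX XE scalerDr -scalerAl mul1r linZ.
  rewrite big_split /=; congr (_ + _).
    rewrite (bigD1 i) //= big1 ?addr0 => [|j /negbTE ji]; last first.
      by rewrite eq_sym ji scale0r scaler0.
    by rewrite eqxx scale1r derivD derivM !derivC derivX mul0r !add0r mulr1 mul_polyC.
  by rewrite mulr_sumr; apply: eq_bigr => j _; rewrite -scalerAr.
- by rewrite lin0 deriv0 big1 // => i _; rewrite mderiv0 lin0 scaler0.
- move=> c p q IHp IHq; rewrite linD linZ derivD derivZ IHp IHq scaler_sumr -big_split.
  apply: eq_bigr => i _ /=; rewrite mderivD mderivZ linD linZ scalerDr !scalerA.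
  by rewrite [c * _]mulrC.
Qed.

Lemma coef0_lin q x w : (lin q x w)`_0 = pfun q x.
Proof. by rewrite -horner_coef0 horner_lin scale0r addr0. Qed.

Lemma coef1_lin q x i : (lin q x (delta_mx 0 i))`_1 = pfun (mderiv i q) x.
Proof.
have := coef_deriv (lin q x (delta_mx 0 i)) 0; rewrite mulr1n => <-.
rewrite deriv_lin coef_sum (bigD1 i) //= big1 ?addr0 => [|j /negbTE ji].
  by rewrite coefZ mxE !eqxx mul1r coef0_lin.
by rewrite coefZ mxE eqxx ji mul0r.
Qed.

(** All partial derivatives of order less than n vanish at [x]; the recursion follows that of
    [Cr_open]. *)
Fixpoint jet_zero (n : nat) q x : Prop :=
  if n is n'.+1 then pfun q x = 0 /\ forall i, jet_zero n' (mderiv i q) x else True.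

Lemma jet_zero_ordat n q x : jet_zero n q x -> ordat n q x.
Proof.
elim: n q => [|n IH] q /=; first by move=> _ w; rewrite expr0 dvd1p.
case=> q0 dq w; apply/dvdp_XnP => -[|k] kn; first by rewrite coef0_lin.
have dv : 'X^n %| (lin q x w)^`().
  rewrite deriv_lin; elim/big_ind: _ => [|a b ha hb|i _]; [exact: dvdp0|exact: dvdp_add|].
  by rewrite -mul_polyC dvdp_mull // IH.
have /dvdp_XnP/(_ k kn) := dv; rewrite coef_deriv => /eqP.
by rewrite -mulr_natr mulf_eq0 pnatr_eq0 orbF => /eqP.
Qed.

Lemma continuous_pfun q : continuous (pfun q).
Proof.
move: q; apply: mpoly3_ind.
- have -> : pfun 1 = fun=> 1 by apply/funext => x; rewrite /pfun meval1.
  by move=> x; apply: cst_continuous.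
- move=> i q IH.
  have -> : pfun (mpolyX R (mnm1 i) * q) = fun x => x ord0 i * pfun q x.
    by apply/funext => x; rewrite /pfun mevalM mevalXU.
  move=> x; apply: continuousM; [exact: coord_continuous | exact: IH].
- have -> : pfun 0 = fun=> 0 by apply/funext => x; rewrite /pfun meval0.
  by move=> x; apply: cst_continuous.
- move=> c p q IHp IHq.
  have -> : pfun (c *: p + q) = (fun x => c * pfun p x) + pfun q.
    by apply/funext => x; rewrite /pfun mevalD mevalZ.
  move=> x; apply: continuousD; last exact: IHq.
  by apply: continuousM; [exact: cst_continuous | exact: IHp].
Qed.

Lemma cvg_difference_quotient q x w :
  ((h^-1 *: (pfun q (h *: w + x) - pfun q x)) @[h --> (0 : R)^'] --> (lin q x w)`_1)%classic.
Proof.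
pose P := drop_poly 1 (lin q x w).
have PE h : pfun q (h *: w + x) = pfun q x + h * P.[h].
  transitivity (lin q x w).[h]; first by rewrite horner_lin [x + _]addrC.
  rewrite -{1}[lin q x w](poly_take_drop 1) hornerD hornerM hornerXn expr1 [_ * h]mulrC.
  rewrite -(coef0_lin q x w); congr (_ + _).
  by rewrite (@size1_polyC _ (take_poly 1 _)) ?size_take_poly // hornerC coef_take_poly.
have -> : (lin q x w)`_1 = P.[0] by rewrite horner_coef0 coef_drop_poly.
apply: (@cvg_trans _ ((fun h => P.[h]) @ (0 : R)^')%classic); last first.
  by apply: cvg_within_filter; apply: continuous_horner.
apply: near_eq_cvg; near=> h.
have h0 : h != 0 by near: h; apply: nbhs_dnbhs_neq.
by rewrite PE addrAC subrr add0r /= -[_ *: (h * _)]/(_ * (h * _)) mulrA mulVf ?mul1r.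
Unshelve. all: by end_near.
Qed.

Lemma derivable_pfun q x i : derivable (pfun q) x (delta_mx 0 i).
Proof. by apply: cvgP; apply: cvg_difference_quotient. Qed.

Lemma derive_pfun q x i : 'D_(delta_mx 0 i) (pfun q) x = pfun (mderiv i q) x.
Proof. by rewrite -coef1_lin; apply: cvg_lim => //; apply: cvg_difference_quotient. Qed.

Lemma Cr_open_pfun r U q : Cr_open r U (pfun q).
Proof.
elim: r q => [|r IH] q /=; (split; first by move=> x _; apply: continuous_pfun) => // i.
split=> [x _|]; first exact: derivable_pfun.
have -> : (fun x => 'D_(delta_mx 0 i) (pfun q) x) = pfun (mderiv i q).
  by apply/funext => x; apply: derive_pfun.
exact: IH.
Qed.

Lemma closure_eq (C : set E) (f g : E -> R) x :
  {for x, continuous f} -> {for x, continuous g} ->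
  (forall y, C y -> f y = g y) -> closure C x -> f x = g x.
Proof.
move=> cf cg fg cl; apply/eqP; rewrite -subr_eq0; apply/negPn/negP => ne.
have c : {for x, continuous (f - g)} := continuousB cf cg.
have /c /cl [y [Cy]] : nbhs ((f - g) x) [set z : R | z != 0]%classic.
  by apply: open_nbhs_nbhs; split; [exact: open_neq | exact: ne].
by rewrite /= -[(f - g) y]/(f y - g y) fg // subrr eqxx.
Qed.

(** On C and C' the partial derivatives of g are those of q and q'. By continuity of those up to
    order r, all of them agree at a common limit point. *)
Lemma jet_zero_sub r (U C C' : set E) g q q' x :
  Cr_open r U g -> open C -> open C' ->
  (C `<=` U)%classic -> (C' `<=` U)%classic -> U x ->
  (forall y, C y -> g y = pfun q y) -> (forall y, C' y -> g y = pfun q' y) ->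
  closure C x -> closure C' x -> jet_zero r.+1 (q - q') x.
Proof.
move=> + oC oC' CU C'U Ux; elim: r g q q' => [|r IH] g q q' /= [cg dg] gq gq' clC clC'.
  split=> //; rewrite /pfun mevalB; apply/eqP; rewrite subr_eq0; apply/eqP.
  rewrite -[LHS](closure_eq (cg _ Ux) (@continuous_pfun q x) gq clC).
  exact: (closure_eq (cg _ Ux) (@continuous_pfun q' x) gq' clC').
split.
  rewrite /pfun mevalB; apply/eqP; rewrite subr_eq0; apply/eqP.
  rewrite -[LHS](closure_eq (cg _ Ux) (@continuous_pfun q x) gq clC).
  exact: (closure_eq (cg _ Ux) (@continuous_pfun q' x) gq' clC').
move=> i; rewrite mderivB; have [_ Cg] := dg i.
apply: (IH _ _ _ Cg) => // y Cy; rewrite -derive_pfun; apply: near_eq_derive.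
  by near=> z; apply: gq; near: z; apply: open_nbhs_nbhs.
by near=> z; apply: gq'; near: z; apply: open_nbhs_nbhs.
Unshelve. all: by end_near.
Qed.

Lemma nbhs_line (B : set E) x w :
  nbhs x B -> exists2 e : R, 0 < e & forall t, 0 < t -> t < e -> B (x + t *: w).
Proof.
case/nbhs_ballP => e /= e0 sub; have n0 : 0 < `|w| + 1 by rewrite ltr_wpDl.
exists (e / (`|w| + 1)); first by rewrite divr_gt0.
move=> t t0; rewrite ltr_pdivlMr // => te; apply: sub.
rewrite -ball_normE /= opprD addrA subrr sub0r normrN normrZ gtr0_norm //.
by move: te; rewrite mulrDr mulr1; lra.
Qed.

Lemma poly_zero_right (P : {poly R}) (e : R) :
  0 < e -> (forall t, 0 < t -> t < e -> P.[t] = 0) -> P = 0.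
Proof.
move=> e0 z; apply/eqP/negPn/negP => /nonroot_small /(_ e0) [t [t0 te]].
by rewrite z ?eqxx.
Qed.

Lemma pfun_open_eq0 (C : set E) q x :
  open C -> C x -> (forall y, C y -> pfun q y = 0) -> q = 0.
Proof.
move=> oC Cx z; apply: meval_fun_eq0 => y.
have [e e0 Ce] := nbhs_line (y - x) (open_nbhs_nbhs (conj oC Cx)).
have l0 : lin q x (y - x) = 0.
  apply: (poly_zero_right e0) => t t0 te; rewrite horner_lin; apply: z; exact: Ce.
by have := horner_lin q x (y - x) 1; rewrite l0 horner0 scale1r addrC subrK.
Qed.

(** Each coefficient of [lin] is polynomial in X and Y, so vanishing on an open triangle extends to
    the plane, first in X and then in Y. *)
Lemma ordplane_extend n q u v :
  (forall X Y, 0 < X -> 0 < Y -> X + Y < 1 -> ordat n q (X *: u + Y *: v)) ->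
  ordplane n q u v.
Proof.
move=> H X Y w; apply/dvdp_XnP => k kn.
pose line (a b : E) : 'rV[{poly R}]_3 := map_mx polyC a + 'X *: map_mx polyC b.
have lineE a b t : map_mx (horner_eval t) (line a b) = a + t *: b.
  by apply/rowP => i; rewrite !mxE /= /horner_eval hornerD hornerM hornerX !hornerC.
have H1 Y' X' : 0 < Y' -> Y' < 1 -> (lin q (X' *: u + Y' *: v) w)`_k = 0.
  move=> Y0 Y1; rewrite addrC -lineE -gen_linE.
  set P := (_)`_k; have -> : P = 0; last by rewrite horner0.
  apply: (@poly_zero_right _ (1 - Y')); rewrite ?subr_gt0 // => t t0 t1.
  rewrite gen_linE lineE addrC.
  have /(_ w)/dvdp_XnP/(_ k kn) // : ordat n q (t *: u + Y' *: v).
  by apply: H => //; move: t1; lra.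
rewrite -lineE -gen_linE; set P := (_)`_k; have -> : P = 0; last by rewrite horner0.
apply: (@poly_zero_right _ 1) => // t t0 t1.
by rewrite gen_linE lineE; apply: H1.
Qed.
End PolynomialFunctions.

(** * From splines to contact conditions, and the dimension *)

Section Splines.
Variables (R : realType) (V : finType) (Delta : {set {set V}}) (p : V -> 'rV[R]_3)
  (gamma : V).
Local Notation E := 'rV[R]_3.
Local Notation tet := (tet gamma).
Local Notation is_tet := (is_tet Delta gamma).
Hypotheses (p0 : p gamma = 0)
  (nondeg : forall u v a, is_tet u v a -> independent3 (p u) (p v) (p a)).

(** The interior of the tetrahedron, whose remaining vertex is 0. *)
Definition cell u v a : set E :=
  [set x | exists c : R * R * R, [/\ 0 < c.1.1, 0 < c.1.2, 0 < c.2,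
     c.1.1 + c.1.2 + c.2 < 1 & x = c.1.1 *: p u + c.1.2 *: p v + c.2 *: p a]]%classic.

Lemma cell_hull u v a : is_tet u v a -> (cell u v a `<=` hull p (tet u v a))%classic.
Proof.
move=> t _ [[[x y] z] /= [x0 y0 z0 s1 ->]]; have [[ug vg ag] [uv ua va]] := is_tet_neq t.
have vu : v == u = false by rewrite eq_sym (negbTE uv).
have au : a == u = false by rewrite eq_sym (negbTE ua).
have av : a == v = false by rewrite eq_sym (negbTE va).
pose w b := if b == u then x else if b == v then y else if b == a then z else
  if b == gamma then 1 - (x + y + z) else 0.
have wu : w u = x by rewrite /w eqxx.
have wv : w v = y by rewrite /w vu eqxx.
have wa : w a = z by rewrite /w au av eqxx.
have wg : w gamma = 1 - (x + y + z).
  by rewrite /w !(eq_sym gamma) (negbTE ug) (negbTE vg) (negbTE ag) eqxx.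
have w0 b : b \notin tet u v a -> w b = 0.
  by rewrite !inE !negb_or /w -!andbA => /and4P [/negbTE -> /negbTE -> /negbTE -> /negbTE ->].
exists w; split=> //.
- by move=> b; rewrite /w; do 4 (case: ifP => _; [lra|]); lra.
- rewrite (bigD1 gamma) //= (bigD1 u) //= (bigD1 v) ?vg ?vu //= (bigD1 a) ?ag ?au ?av //=.
  rewrite big1 ?wg ?wu ?wv ?wa; first by ring.
  by move=> b /andP [/andP [/andP [bg bu] bv] ba]; rewrite w0 // !inE !negb_or bg bu bv ba.
- rewrite (bigD1 gamma) //= (bigD1 u) //= (bigD1 v) ?vg ?vu //= (bigD1 a) ?ag ?au ?av //=.
  rewrite big1 ?wg ?wu ?wv ?wa; first by rewrite p0 scaler0 add0r addr0 addrA.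
  move=> b /andP [/andP [/andP [bg bu] bv] ba].
  by rewrite w0 ?scale0r // !inE !negb_or bg bu bv ba.
Qed.

Lemma cell_open u v a : is_tet u v a -> open (cell u v a).
Proof.
move=> t; have Mu := (independent3P _ _ _).1 (nondeg t).
set M := mat3 _ _ _ in Mu.
pose L j : mpoly 3 R := \sum_i (invmx M) i j *: mpolyX R (mnm1 i).
have LE j x : pfun (L j) x = (x *m invmx M) ord0 j.
  rewrite /pfun /L raddf_sum mxE; apply: eq_bigr => i _ /=.
  by rewrite mevalZ mevalXU mulrC.
have -> : cell u v a = ((pfun (L ord0) @^-1` [set y | 0 < y]) `&`
    (pfun (L (inord 1)) @^-1` [set y | 0 < y]) `&`
    (pfun (L (inord 2)) @^-1` [set y | 0 < y]) `&`
    (pfun (L ord0 + L (inord 1) + L (inord 2)) @^-1` [set y | y < 1]))%classic.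
  have sumE x : pfun (L ord0 + L (inord 1) + L (inord 2)) x =
      pfun (L ord0) x + pfun (L (inord 1)) x + pfun (L (inord 2)) x.
    by rewrite /pfun !mevalD.
  apply/seteqP; split=> x /=.
    case=> -[[x1 y1] z1] /= [h1 h2 h3 h4 xE].
    have e : x *m invmx M = vec x1 y1 z1 by rewrite xE -mul_vec_mat3 mulmxK.
    by rewrite sumE !LE e !mxE /= !inordK //=; do !split.
  rewrite sumE !LE; case=> -[[h1 h2] h3] h4.
  exists ((x *m invmx M) ord0 ord0, (x *m invmx M) ord0 (inord 1), (x *m invmx M) ord0 (inord 2)).
  by split=> //=; rewrite -mul_vec_mat3 -vecE mulmxKV.
have oc (q : mpoly 3 R) (D : set R) : open D -> open (pfun q @^-1` D)%classic.
  by move=> oD; apply: open_comp => // x _; apply: continuous_pfun.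
by do 3 (apply: openI; [|apply: oc; (exact: open_gt || exact: open_lt)]); apply: oc; exact: open_gt.
Qed.

Lemma closure_cell u v a (X Y : R) : is_tet u v a -> 0 < X -> 0 < Y -> X + Y < 1 ->
  closure (cell u v a) (X *: p u + Y *: p v).
Proof.
move=> t X0 Y0 XY B /(nbhs_line (p a)) [e e0 Be].
pose s := Num.min (e / 2) ((1 - X - Y) / 2).
have s0 : 0 < s by rewrite lt_min !divr_gt0 // subr_gt0; lra.
have se : s < e by rewrite gt_min; apply/orP; left; lra.
have s1 : s < 1 - X - Y by rewrite gt_min; apply/orP; right; lra.
exists (X *: p u + Y *: p v + s *: p a); split; last exact: Be.
exists (X, Y, s); split=> //=; lra.
Qed.

Lemma is_tet_Delta u v a : is_tet u v a -> tet u v a \in Delta.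
Proof. by rewrite /is_tet inE => /andP []. Qed.

(** A point inside the common triangle is a limit of both open cells, so the jets agree there; r + 1
    counts the orders from 0 to r. *)
Lemma spline_smooth r (U : set E) (g : E -> R) (q : {set V} -> mpoly 3 R) :
  (realization Delta p `<=` U)%classic -> Cr_open r U g ->
  (forall T x, T \in tetrahedra Delta -> hull p T x -> g x = pfun (q T) x) ->
  smooth Delta gamma r.+1 (fun u _ => p u) (fun _ v => p v) q.
Proof.
move=> DU Cg gq u v a b ta tb; apply: ordplane_extend => X Y X0 Y0 XY.
apply: jet_zero_ordat.
have sub c : is_tet u v c -> (cell u v c `<=` U)%classic.
  move=> tc x /(cell_hull tc) h; apply: DU; exists (tet u v c) => //=.
  exact: is_tet_Delta.
have ag c : is_tet u v c -> forall y, cell u v c y -> g y = pfun (q (tet u v c)) y.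
  by move=> tc y /(cell_hull tc); apply: gq.
apply: (jet_zero_sub Cg (cell_open ta) (cell_open tb) (sub _ ta) (sub _ tb) _ (ag _ ta) (ag _ tb)).
- apply: DU; exists (tet u v a); first exact: is_tet_Delta.
  have [[ug vg _] [uv _ _]] := is_tet_neq ta.
  have vu : v == u = false by rewrite eq_sym (negbTE uv).
  exists (fun b => if b == u then X else if b == v then Y else if b == gamma then 1 - X - Y else 0); split.
  + by move=> c; do 3 (case: ifP => _; [lra|]); lra.
  + by move=> c; rewrite !inE !negb_or -!andbA => /and4P [/negbTE -> /negbTE -> /negbTE -> _].
  + rewrite (bigD1 u) //= eqxx (bigD1 v) ?vu //= ?vu eqxx.
    rewrite (bigD1 gamma) /=; last by rewrite !(eq_sym gamma) ug vg.
    rewrite !(eq_sym gamma) (negbTE ug) (negbTE vg) eqxx big1 ?addr0; first by ring.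
    by move=> c /andP [/andP [/negbTE -> /negbTE ->] /negbTE ->].
  + rewrite (bigD1 u) //= eqxx (bigD1 v) ?vu //= ?vu eqxx.
    rewrite big1 ?addr0 // => c /andP [/negbTE -> /negbTE ->].
    by case: eqP => [->|_]; rewrite ?p0 ?scaler0 ?scale0r.
- exact: closure_cell.
- exact: closure_cell.
Qed.

(** By rigidity every spline is the restriction of one form of degree d. Distinct forms have
    distinct restrictions, since the realization contains an open cell. *)
Lemma rigid_has_dim r d : closed_link Delta gamma -> (4 < #|V|)%N -> pure3 Delta ->
  rigid_at Delta gamma r.+1 d p -> has_dim (spline_space Delta p r d) 'C(d + 2, 2).
Proof.
move=> HL V5 pure rig; have [b [bh bspan bfree]] := homogeneous_basis R d.
have [u0 [v0 [a0 t0]]] := tet_exists HL (ltnW (ltnW (ltnW V5))).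
have comb (c : 'I_('C(d + 2, 2)) -> R) (x : realization Delta p) :
    (\sum_i c i *: (fun x : realization Delta p => pfun (b i) (val x) : R^o)) x =
    pfun (\sum_i c i *: b i) (val x).
  rewrite /pfun raddf_sum fct_sumE; apply: eq_bigr => i _ /=.
  by rewrite mevalZ.
exists (fun i x => pfun (b i) (val x)); split.
  move=> c c0; apply: bfree.
  pose h : R := 1 / 4.
  have Cx : cell u0 v0 a0 (h *: p u0 + h *: p v0 + h *: p a0).
    by exists (h, h, h); split=> //=; rewrite /h; lra.
  apply: (pfun_open_eq0 (cell_open t0) Cx) => y Cy.
  have yD : y \in realization Delta p.
    by apply/mem_set; exists (tet u0 v0 a0); [exact: is_tet_Delta | exact: cell_hull Cy].
  have := comb c (SigSub yD); rewrite c0 /= => <-.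
  by [].
apply/seteqP; split=> f /=.
  case=> -[U [g [oU DU Cg fg]]] fT.
  have choose T : exists q, homogeneous d q /\ (T \in tetrahedra Delta ->
      forall x : realization Delta p, hull p T (val x) -> f x = pfun q (val x)).
    case: (boolP (T \in tetrahedra Delta)) => [/fT [q hq fq]|_]; first by exists q.
    by exists 0; split=> //; apply: rpred0.
  have /fin_all_exists [q hq] := choose.
  have agree T x : T \in tetrahedra Delta -> hull p T x -> g x = pfun (q T) x.
    move=> Tt hx; have xD : x \in realization Delta p.
      by apply/mem_set; exists T => //=; move: Tt; rewrite inE => /andP [].
    by have := (hq T).2 Tt (SigSub xD) hx; rewrite fg.
  have sm := spline_smooth DU Cg agree.
  have const := rig q (fun T => (hq T).1) sm.
  have [c cE] := bspan _ (hq (tet u0 v0 a0)).1.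
  exists c => //; apply/funext => x; rewrite comb -cE.
  have /set_mem [s /= sD hx] := valP x.
  have [T Tt sT] := pure s sD.
  rewrite (hq T).2 //; last exact: hullS hx.
  by rewrite (const T (tet u0 v0 a0)).
case=> c _ <-; split.
  exists setT, (pfun (\sum_i c i *: b i)); split.
  - exact: openT.
  - by [].
  - exact: Cr_open_pfun.
  - by move=> x; apply: comb.
move=> T _; exists (\sum_i c i *: b i).
  by rewrite /homogeneous rpred_sum // => i _; apply/rpredZ/bh.
by move=> x _; apply: comb.
Qed.
End Splines.

Theorem theorem1p3 (R : realType) (V : finType) (Delta : {set {set V}})
    (p : V -> 'rV[R]_3) (gamma : V) (r d : nat)
    (hstar : vertex_star Delta p gamma)
    (hclosed : closed_star Delta p gamma)
    (hgen : generic Delta p gamma r d)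
    (hd : (d <= D_gamma (num_interior_edges Delta p) r)%N) :
  has_dim (spline_space Delta p r d) 'C(d + 2, 2).
Proof.
have HL := star_closed_link hstar hclosed.
have V5 := card_vertices_gt4 hstar hclosed.
have dV : (d <= D_gamma #|V|.-1 r)%N.
  apply: leq_trans hd (D_gamma_antitone _ _ (num_interior_edges_ge hstar hclosed)).
  by rewrite -ltnS prednK // (leq_trans _ V5).
have [p1 p1g rig1] := exists_rigid_D_gamma R HL V5 dV.
have [eps eps0 gen] := hgen.
(* The segment from the given position, t = 0, to the rigid one, t = 1. *)
pose line v : 'rV[{poly R}]_3 := map_mx polyC (p v) + 'X *: map_mx polyC (p1 v - p v).
pose pt t v := p v + t *: (p1 v - p v).
have lineE t v : map_mx (horner_eval t) (line v) = pt t v.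
  by apply/rowP => i; rewrite !mxE /= /horner_eval hornerD hornerM hornerX !hornerC.
have evalE t : eval_at t (fun u _ => line u) = (fun u _ => pt t u) /\
    eval_at t (fun _ v => line v) = (fun _ v => pt t v).
  by split; apply/funext => u; apply/funext => v; apply: lineE.
have rig1' : rigid Delta gamma r.+1 d (eval_at 1 (fun u _ => line u)) (eval_at 1 (fun _ v => line v)).
  have [-> ->] := evalE 1; have -> // : pt 1 = p1.
  by apply/funext => v; rewrite /pt scale1r addrC subrK.
have [D D0 HD] := rigid_generic rig1'.
pose N (x : V * V * V) := \det (mat3 (line x.1.1) (line x.1.2) (line x.2)).
have NE t x : (N x).[t] = \det (mat3 (pt t x.1.1) (pt t x.1.2) (pt t x.2)).
  rewrite -[LHS]/(horner_eval t _) -det_map_mx; congr (\det _).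
  by rewrite map_mat3 !lineE.
(* F is nonzero because no tetrahedron is degenerate at t = 0; where F does not vanish, none is
   degenerate either. *)
pose F := \prod_(x | is_tet Delta gamma x.1.1 x.1.2 x.2) N x.
have F0 : F != 0.
  apply/prodf_neq0 => -[[u v] a] /= t; apply/eqP => N0.
  have := NE 0 (u, v, a); rewrite N0 horner0 /pt !scale0r !addr0 /= => /esym/eqP.
  have /independent3P := tet_li hstar t.
  by rewrite unitmxE unitfE => /negbTE ->.
have [e e0 He] := finite_lower_bound
  (fun v => divr_gt0 eps0 (ltr_wpDl (normr_ge0 (p1 v - p v)) (@ltr01 R))).
(* This t keeps all vertices within [eps], the position rigid and the tetrahedra nondegenerate. *)
have [t [t0 te DFt]] := nonroot_small (mulf_neq0 D0 F0) e0.
move: DFt; rewrite hornerM mulf_eq0 negb_or => /andP [Dt Ft].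
have ptg : pt t gamma = p gamma.
  by rewrite /pt p1g (star_origin hstar) subrr scaler0 addr0.
apply/(gen (pt t) ptg).
  move=> v; rewrite /pt addrAC subrr add0r normrZ gtr0_norm //.
  have n0 : 0 < `|p1 v - p v| + 1 by rewrite ltr_wpDl.
  have := lt_le_trans te (He v); rewrite ltr_pdivlMr // mulrDr mulr1; lra.
apply: (rigid_has_dim (gamma := gamma)) => //.
- by rewrite ptg (star_origin hstar).
- move=> u v a tt; apply/independent3P; rewrite unitmxE unitfE.
  have := Ft; rewrite horner_prod => /prodf_neq0 /(_ (u, v, a) tt).
  by rewrite NE.
- exact: star_pure hstar.
- by have := HD t Dt; have [-> ->] := evalE t.
Qed.
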